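(* Let $c>0$ and $c_1=|\Gamma(-\tfrac14)|$. Suppose $b_0\in C(\mathbb{R}_+)$ and there is a constant $C>0$ such that $|b_0(t)|+|b_0'(t)|\le C(1+t)^{-2}$ for $t\ge 0$. Then the solution $b$ to the equation $$b(t)=b_0(t)-cc_1\,\big(\Phi_{-1/4}\star b\big)(t)$$ exists, is unique, and belongs to $C(\mathbb{R}_+)$.
   Context: $\mathbb{R}_+=[0,\infty)$. For $\lambda\in\mathbb{C}$, $\Phi_\lambda(t):=\frac{t_+^{\lambda-1}}{\Gamma(\lambda)}$, where $t_+=t$ for $t\ge0$ and $t_+=0$ for $t<0$. For $\lambda>0$, $(\Phi_\lambda\star b)(t)=\int_0^t\Phi_\lambda(t-s)b(s)\,ds$ classically. For $\lambda\le0$ this integral diverges classically and the convolution is defined through the Laplace transform $L(b)(p)=\int_0^\infty e^{-pt}b(t)\,dt$: one has $L(\Phi_\lambda)=p^{-\lambda}$ for $\lambda>0$, and this is extended to the other values of $\lambda$ by analytic continuation in $\lambda$; then $\Phi_\lambda\star b:=L^{-1}\big(p^{-\lambda}L(b)\big)$. In particular $L(\Phi_{-1/4}\star b)=p^{1/4}L(b)$. With this definition the equation is the interpretation of the hyper-singular equation $b(t)=b_0(t)+c\int_0^t(t-s)^{-5/4}b(s)\,ds$, since $\Gamma(-\tfrac14)=-c_1<0$. *)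

(* Defs.v *)
From HB Require Import structures.
From mathcomp Require Export all_boot all_order all_algebra.
From mathcomp Require Export all_classical all_reals all_analysis.
From mathcomp Require Export complex.
Export Order.TTheory GRing.Theory Num.Theory.
Export numFieldNormedType.Exports.

Set Implicit Arguments.
Unset Strict Implicit.
Unset Printing Implicit Defensive.

Local Open Scope classical_set_scope.
Local Open Scope ring_scope.
Local Open Scope complex_scope.

Section Defs.
Context {R : realType}.

Definition Gamma_integral (x : R) : R :=
  \int[lebesgue_measure]_(t in `]0, +oo[) (t `^ (x - 1) * expR (- t)).

(* For x <= 0, Gamma(x) = Gamma(x + n) / (x (x + 1) ... (x + n - 1)) with n the
   least natural number such that 0 < x + n; the value at the poles
   0, -1, -2, ... is a meaningless 0. *)
Definition Gamma (x : R) : R :=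
  let n := if 0 < x then 0%N else (Num.truncn (- x)).+1 in
  Gamma_integral (x + n%:R) / \prod_(i < n) (x + i%:R).

Definition cexp (z : R[i]) : R[i] :=
  (expR (complex.Re z) * cos (complex.Im z)) +i* (expR (complex.Re z) * sin (complex.Im z)).

(* This is the principal logarithm only on the half-plane 0 < Re z; it is used
   nowhere else. *)
Definition clog (z : R[i]) : R[i] :=
  ln (Num.sqrt (complex.Re z ^+ 2 + complex.Im z ^+ 2)) +i* atan (complex.Im z / complex.Re z).

Definition cpow (z : R[i]) (mu : R) : R[i] := cexp (mu%:C * clog z).

(* A function on R_+ is represented by a function on R whose values at negative
   arguments are irrelevant. *)
Definition laplace_integrand (b : R -> R) (p : R[i]) (t : R) : R[i] :=
  cexp (- (p * t%:C)) * (b t)%:C.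

Definition laplace_converges (b : R -> R) (p : R[i]) : Prop :=
  lebesgue_measure.-integrable `[0, +oo[
    (fun t => (complex.Re (laplace_integrand b p t))%:E) /\
  lebesgue_measure.-integrable `[0, +oo[
    (fun t => (complex.Im (laplace_integrand b p t))%:E).

Definition laplace (b : R -> R) (p : R[i]) : R[i] :=
  (\int[lebesgue_measure]_(t in `[0, +oo[) complex.Re (laplace_integrand b p t)) +i*
  (\int[lebesgue_measure]_(t in `[0, +oo[) complex.Im (laplace_integrand b p t)).

(* g is the convolution of Phi_lambda and b, that is, g is an inverse Laplace
   transform of p^(-lambda) L(b)(p). It is a relation because the inverse
   transform is only determined up to a Lebesgue-null set. *)
Definition is_Phi_conv (lambda : R) (b g : R -> R) : Prop :=
  exists2 sigma : R, 0 <= sigma &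
    forall p : R[i], sigma < complex.Re p ->
      [/\ laplace_converges b p, laplace_converges g p &
          laplace g p = cpow p (- lambda) * laplace b p].

(* b = b0 - k (Phi_lambda * b) on R_+ *)
Definition is_solution (lambda k : R) (b0 b : R -> R) : Prop :=
  exists2 g : R -> R, is_Phi_conv lambda b g &
    forall t, 0 <= t -> b t = b0 t - k * g t.

(* Derivative of a function on R_+; one-sided at 0. *)
Definition is_derivative_Rplus (f df : R -> R) : Prop :=
  forall t, 0 <= t ->
    (f s - f t) / (s - t) @[s --> within `[0, +oo[ t^'] --> df t.

End Defs.

(* Main.v *)
From HB Require Import structures.
Require Import Defs.
From mathcomp Require Import measurable_realfun ring lra zify.

(** Put [k = c c_1], which is positive because [Gamma (-1/4)] is not 0. In terms
    of Laplace transforms a solution satisfies [b = b0 - k g] with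
    [L(g) = p^(1/4) L(b)], or equivalently [L(b) = p^(-1/4) L(g)]: convolving
    with [Phi_(1/4)] turns the hyper-singular equation into the Volterra
    equation [k b = Phi_(1/4) * (b0 - b)], whose kernel has an integrable
    singularity.

    Existence. Substituting [s = t - u^4] in the convolution integral gives
    [(Phi_(1/4) * w) (t) = (1 / G) int_R w (t - u^4) du] for [w] vanishing on
    negative times, with [G = int_R exp (- u^4) du]. So the singular kernel
    becomes the constant 1, and only smooth integrands occur. After weighting by
    [exp (- sg t)] with [sg] large, the operator contracts the uniform norm by
    the factor 1/2; its fixed point is the limit of the Picard iteration
    ([picard_lim_fixed]). It is continuous because the operator maps bounded
    functions with a single jump to continuous functions
    ([continuous_volterra_op]). To return to the transforms one needs the
    convolution theorem, which here is the theorem of Fubini with a translation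
    ([integrable_convolution]), and the identity
    [int_R exp (- p u^4) du = G p^(-1/4)] for all complex [p] with [Re p > 0].
    The latter ([quartic_laplace]) is proved by moving from 1 to [p] along
    [exp (s log p)]: the derivative in [s] of
    [exp (s (log p) / 4) exp (- exp (s log p) u^4)] is the derivative in [u] of a
    function that vanishes at infinity.

    Uniqueness. The difference [d] of two solutions satisfies
    [(1 + k p^(1/4)) L(d)(p) = 0], so [L(d)(p) = 0] for all large real [p], and
    [d] vanishes almost everywhere by Lerch's theorem ([laplace_injective]).
    Lerch's theorem is proved by approximating the indicator functions of
    half-lines by explicit combinations of decaying exponentials. *)

Set Implicit Arguments.
Unset Strict Implicit.
Unset Printing Implicit Defensive.

Local Open Scope classical_set_scope.
Local Open Scope ring_scope.

(** * Integrals on the real line *)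

Section integration.
Context {R : realType}.
Local Notation mu := (@lebesgue_measure R).

Lemma integrable_measurable_fun (D : set R) (f : R -> R) :
  mu.-integrable D (EFin \o f) -> measurable_fun D f.
Proof. by move=> /integrableP[/measurable_EFinP]. Qed.

Lemma integrable_le_norm (D : set R) (f g : R -> R) : measurable D ->
  measurable_fun D f -> mu.-integrable D (EFin \o g) ->
  (forall x, D x -> `|f x| <= g x) -> mu.-integrable D (EFin \o f).
Proof.
move=> mD mf ig fg; apply: le_integrable ig => //.
  exact/measurable_EFinP.
by move=> x Dx /=; rewrite lee_fin (le_trans (fg _ Dx))// ler_norm.
Qed.

Lemma Rintegral_norm_le (D : set R) (f g : R -> R) : measurable D ->
  measurable_fun D f -> mu.-integrable D (EFin \o g) ->
  (forall x, D x -> `|f x| <= g x) ->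
  `|\int[mu]_(x in D) f x| <= \int[mu]_(x in D) g x.
Proof.
move=> mD mf ig fg; have intf := integrable_le_norm mD mf ig fg.
rewrite (le_trans (le_normr_Rintegral _ _))//.
by apply: le_Rintegral => //; exact: integrable_norm.
Qed.

Lemma Rintegral_dominated_cvg (D : set R) (f_ : nat -> R -> R) (f g : R -> R) :
  measurable D -> (forall n, measurable_fun D (f_ n)) -> measurable_fun D f ->
  {ae mu, forall x, D x -> f_ n x @[n --> \oo] --> f x} ->
  mu.-integrable D (EFin \o g) -> (forall n x, D x -> `|f_ n x| <= g x) ->
  \int[mu]_(x in D) f_ n x @[n --> \oo] --> \int[mu]_(x in D) f x.
Proof.
move=> mD mf_ mf f_f ig f_g.
have [||||iF _ cF] := @dominated_convergence _ _ _ mu D mD (fun n => EFin \o f_ n)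
   (EFin \o f) (EFin \o g) _ _ _ ig.
- by move=> n; apply/measurable_EFinP; exact: mf_.
- by apply/measurable_EFinP; exact: mf.
- apply: filterS f_f => [|x + Dx /=]; first exact: (ae_filter_ringOfSetsType mu).
  move=> /(_ Dx) h.
  by apply: cvg_EFin h; exact: nearW.
- by apply: aeW => x n Dx /=; rewrite lee_fin f_g.
apply: fine_cvg; rewrite fineK//.
exact: integrable_fin_num.
Qed.

Lemma Rintegral_halfline (F : R -> R) : (forall t, t < 0 -> F t = 0) ->
  \int[mu]_(t in `[0, +oo[) F t = \int[mu]_t F t.
Proof.
move=> F0; rewrite Rintegral_mkcond; apply: eq_Rintegral => t _.
rewrite patchE; case: ifPn => // /negP; rewrite inE/= in_itv/= andbT => /negP.
by rewrite -ltNge => /F0.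
Qed.

Lemma integrable_halfline (F : R -> R) : mu.-integrable setT (EFin \o F) ->
  mu.-integrable `[0, +oo[ (EFin \o F).
Proof. by move=> iF; apply: integrableS iF. Qed.

(** Integrability on the half-line is obtained by comparison with the density
    of an exponential law, whose integral is known. *)
Lemma exp_halfline_integrable (a K : R) (F : R -> R) : 0 < a ->
  measurable_fun setT F -> (forall t, t < 0 -> F t = 0) ->
  (forall t, 0 <= t -> `|F t| <= K * expR (- (a * t))) ->
  mu.-integrable setT (EFin \o F).
Proof.
move=> a0 mF F0 FK.
apply: (@integrable_le_norm _ _ (fun t => K / a * exponential_pdf a t)) => //.
  exact: (integrableZl measurableT (K / a) (integrable_exponential_pdf a0)).
move=> t _; have [t0|t0] := ltP t 0.
  by rewrite F0// normr0 lt0_exponential_pdf// mulr0.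
rewrite exponential_pdfE// /exponential_pdf mulrA divfK ?gt_eqF// mulNr.
exact: FK.
Qed.

Lemma translation_measurable (a : R) :
  measurable_fun [set: R] (fun t : R => t - a).
Proof. by apply: measurable_funB. Qed.

(** Both measures give the interval ]x, y] the mass y - x, and a measure on the
    Borel sets is determined by these values. *)
Lemma lebesgue_measure_translation (a : R) (A : set R) : measurable A ->
  pushforward mu (fun t : measurableTypeR R => (t - a : measurableTypeR R)) A
  = mu A.
Proof.
move=> mA; apply/esym.
pose mphi := isMeasurableFun.Build _ _ (measurableTypeR R)
  (measurableTypeR R) _ (translation_measurable a).
pose phi : {mfun measurableTypeR R >-> measurableTypeR R} :=
  HB.pack (fun t : R => t - a) mphi.
rewrite -[pushforward _ _]/(pushforward mu phi).
apply: lebesgue_measure_unique => //= _ [[x y]] _ <-.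
rewrite /pushforward.
have -> : phi @^-1` `]x, y] = `](x + a), (y + a)]%classic.
  by apply/seteqP; split=> t /=; rewrite !in_itv/= lerBlDr ltrBrDr.
rewrite !lebesgue_measure_itv/= !lte_fin ltrD2r.
by case: ifP => // _; rewrite -!EFinD opprD addrACA subrr addr0.
Qed.

Lemma ge0_integral_translation (a : R) (f : R -> \bar R) :
  measurable_fun setT f -> (forall x, 0 <= f x)%E ->
  (\int[mu]_t f (t - a)%R = \int[mu]_t f t)%E.
Proof.
move=> mf f0.
have /= <- := @ge0_integral_pushforward _ _ (measurableTypeR R)
  (measurableTypeR R) R _ (translation_measurable a) mu setT f measurableT mf
  (fun y _ => f0 y).
apply: eq_measure_integral => [|mphi A mA _]; first exact: translation_measurable.
exact: lebesgue_measure_translation.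
Qed.

Lemma integrable_translation (a : R) (f : R -> R) :
  mu.-integrable setT (EFin \o f) ->
  mu.-integrable setT (EFin \o (fun t => f (t - a))).
Proof.
move=> /integrableP[mf fi]; apply/integrableP; split.
  apply: (@measurableT_comp _ _ _ _ _ _ (EFin \o f)) => //.
  exact: translation_measurable.
rewrite [X in (X < _)%E](_ : _ = \int[mu]_t `|(EFin \o f) t|)%E//.
apply: (@ge0_integral_translation a (fun t => `|(EFin \o f) t|)%E) => //.
exact: measurableT_comp.
Qed.

Lemma integral_translation (a : R) (f : R -> R) :
  mu.-integrable setT (EFin \o f) ->
  (\int[mu]_t (f (t - a)%R)%:E = \int[mu]_t (f t)%:E)%E.
Proof.
move=> fi.
have /= <- := @integral_pushforward _ _ (measurableTypeR R)
  (measurableTypeR R) R _ (translation_measurable a) mu setT (EFin \o f)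
  (measurable_int _ fi) (integrable_translation a fi) measurableT.
apply: eq_measure_integral => [|mphi A mA _]; first exact: translation_measurable.
exact: lebesgue_measure_translation.
Qed.

End integration.

(** * Convolution and Fubini's theorem *)

Section fubini.
Context {R : realType}.
Local Notation mu := (@lebesgue_measure R).

(** Translating the inner integral in [t] by [phi u] turns the double integral
    into a product. The change of time [phi u] in place of [u] lets a singular
    convolution kernel be replaced by a smooth one. The last hypothesis makes
    the inner integral finite for every [t] and not merely for almost all. *)
Lemma integrable_convolution (h f phi : R -> R) : measurable_fun setT phi ->
  mu.-integrable setT (EFin \o h) -> mu.-integrable setT (EFin \o f) ->
  (forall t, mu.-integrable setT (EFin \o (fun u => h u * f (t - phi u)))) ->
  mu.-integrable setT (EFin \o (fun t => \int[mu]_u (h u * f (t - phi u)))) /\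
  \int[mu]_t \int[mu]_u (h u * f (t - phi u)) =
  (\int[mu]_u h u) * \int[mu]_t f t.
Proof.
move=> mphi ih jf ihf.
have mh : measurable_fun setT h by exact: integrable_measurable_fun.
have mf : measurable_fun setT f by exact: integrable_measurable_fun.
pose F (z : measurableTypeR R * measurableTypeR R) : \bar R :=
  (h z.2 * f (z.1 - phi z.2))%:E.
have mF : measurable_fun setT F.
  apply/measurable_EFinP; apply: measurable_funM.
    exact: measurableT_comp.
  apply: measurableT_comp => //; apply: measurable_funB => //.
  exact: measurableT_comp.
have intF : (mu \x mu)%E.-integrable setT F.
  apply/(integrable21ltyP _ _ mF).
  pose K := (\int[mu]_t `|f t|%:E)%E.
  have Kfin : K \is a fin_num.
    by apply: integrable_fin_num => //; exact: integrable_norm.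
  rewrite (_ : (fun u => _) = (fun u => `|h u|%:E * K)%E).
    rewrite ge0_integralZr//; last 2 first.
      by apply/measurable_EFinP; exact: measurableT_comp.
      by apply: integral_ge0 => t _; rewrite lee_fin.
    apply: lte_mul_pinfty => //.
      by apply: integral_ge0 => t _; rewrite lee_fin.
    apply: integrable_fin_num => //; exact: integrable_norm.
    by rewrite ltey_eq Kfin.
  apply/funext => u.
  under eq_integral do rewrite /F/= normrM EFinM.
  rewrite ge0_integralZl//; last first.
    apply/measurable_EFinP; apply: measurableT_comp => //.
    apply: (measurableT_comp mf); exact: translation_measurable.
  congr (_ * _)%E.
  apply: (@ge0_integral_translation _ (phi u) (fun t => `|f t|%:E)) => //.
  by apply/measurable_EFinP; exact: measurableT_comp.
have FE : fubini_F mu F = EFin \o (fun t => \int[mu]_u (h u * f (t - phi u))).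
  apply/funext => t; rewrite /fubini_F/= /Rintegral fineK//.
  by apply: integrable_fin_num => //; exact: ihf.
split; first by rewrite -FE; exact: integrable_fubini_F.
rewrite /Rintegral -fineM; try by apply: integrable_fin_num.
congr fine.
transitivity (\int[mu]_t fubini_F mu F t)%E; first by rewrite FE.
rewrite (integral12_prod_meas1 intF) -(integral21_prod_meas1 intF).
have Kfin : (\int[mu]_t (f t)%:E)%E \is a fin_num by apply: integrable_fin_num.
rewrite -[X in (_ * X)%E](fineK Kfin) -integralZr// (fineK Kfin).
apply: eq_integral => u _; rewrite /fubini_G /F/=.
under eq_integral do rewrite EFinM.
rewrite integralZl//; last exact: integrable_translation.
by congr (_ * _)%E; exact: integral_translation.
Qed.

(** For [phi u = u^4] and a constant [h] the inner integral is a convolution with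
    a multiple of [t^(-3/4)], when [F] vanishes on negative times. *)
Lemma quartic_convolution (h F : R -> R) (K : R) :
  mu.-integrable setT (EFin \o h) -> mu.-integrable setT (EFin \o F) ->
  (forall t, `|F t| <= K) ->
  [/\ forall t, mu.-integrable setT (EFin \o (fun u => h u * F (t - u ^+ 4))),
  mu.-integrable setT (EFin \o (fun t => \int[mu]_u (h u * F (t - u ^+ 4)))) &
  \int[mu]_t \int[mu]_u (h u * F (t - u ^+ 4)) =
  (\int[mu]_u h u) * \int[mu]_t F t].
Proof.
move=> ih iF FK.
have mh := integrable_measurable_fun ih.
have mF := integrable_measurable_fun iF.
have ihF t : mu.-integrable setT (EFin \o (fun u => h u * F (t - u ^+ 4))).
  apply: (@integrable_le_norm _ _ _ (fun u => K * `|h u|)) => //.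
  - apply: measurable_funM => //; apply: measurableT_comp => //.
    exact: measurable_funB.
  - exact: (integrableZl measurableT K (integrable_norm ih)).
  - by move=> u _; rewrite normrM mulrC ler_wpM2r.
have mphi : measurable_fun setT (fun u : R => u ^+ 4) by exact: measurable_funX.
by have [] := integrable_convolution mphi ih iF ihF.
Qed.

End fubini.

(** * Lerch's theorem *)

Section lerch.
Context {R : realType}.
Local Notation mu := (@lebesgue_measure R).

Lemma bernoulli_expr_ge (x : R) n : 0 <= x <= 1 -> 1 - n%:R * x <= (1 - x) ^+ n.
Proof.
move=> x01; elim: n => [|n IH]; first by rewrite mul0r subr0 expr0.
rewrite exprS; apply: (@le_trans _ _ ((1 - x) * (1 - n%:R * x))).
  by have : 0 <= n%:R :> R by []; rewrite -natr1; nra.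
by rewrite ler_wpM2l//; lra.
Qed.

Lemma bernoulli_expr_le (x : R) n :
  0 <= x <= 1 -> (1 - x) ^+ n * (1 + n%:R * x) <= 1.
Proof.
move=> x01; elim: n => [|n IH]; first by rewrite mul0r addr0 expr0 mul1r.
apply: le_trans IH; rewrite exprSr -mulrA ler_wpM2l//.
  by rewrite exprn_ge0//; lra.
by have : 0 <= n%:R :> R by []; rewrite -natr1; nra.
Qed.

(** On [0 < z <= 1], except at [z = 1/2], these polynomials converge boundedly to
    the indicator function of [z < 1/2]: [2^m * z^m] tends to 0 or to infinity
    according to the side of [1/2] on which [z] lies. *)
Definition cutoff (m : nat) (z : R) : R := (1 - z ^+ m) ^+ (2 ^ m).

Lemma cutoff_ge0 m z : 0 <= z <= 1 -> 0 <= cutoff m z.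
Proof.
by move=> /andP[z0 z1]; rewrite exprn_ge0// subr_ge0 exprn_ile1.
Qed.

Lemma cutoff_le1 m z : 0 <= z <= 1 -> cutoff m z <= 1.
Proof.
move=> /andP[z0 z1]; rewrite exprn_ile1 ?subr_ge0 ?exprn_ile1//.
by rewrite lerBlDr lerDl exprn_ge0.
Qed.

Lemma cutoff_cvg0 (z : R) : 2^-1 < z <= 1 -> cutoff m z @[m --> \oo] --> (0 : R).
Proof.
move=> /andP[z2 z1].
have z0 : 0 < z by lra.
have zz : `|(2 * z)^-1| < 1.
  by rewrite ger0_norm ?invr_ge0 ?mulr_ge0 ?(ltW z0)// invf_lt1 ?mulr_gt0//; lra.
apply: (squeeze_cvgr _ (cvg_cst 0) (cvg_expr zz)).
apply: nearW => m.
rewrite cutoff_ge0/=; last by rewrite z1 ltW.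
have zm : 0 <= z ^+ m <= 1 by rewrite exprn_ge0 ?exprn_ile1// ltW.
have zmp : 0 < 2 ^+ m * z ^+ m by rewrite mulr_gt0 ?exprn_gt0.
rewrite exprVn exprMn -[leRHS]mul1r ler_pdivlMr//.
have := bernoulli_expr_le (2 ^ m) zm; rewrite natrX; apply: le_trans.
rewrite ler_wpM2l ?lerDr ?ler01//.
by rewrite cutoff_ge0// z1 ltW.
Qed.

Lemma cutoff_cvg1 (z : R) : 0 < z < 2^-1 -> cutoff m z @[m --> \oo] --> (1 : R).
Proof.
move=> /andP[z0 z2].
have zz : `|2 * z| < 1 by rewrite ger0_norm ?mulr_ge0 ?(ltW z0)//; lra.
have c0 : 1 - (2 * z) ^+ m @[m --> \oo] --> (1 : R).
  by rewrite -[X in _ --> X]subr0; apply: cvgB (cvg_cst _) (cvg_expr zz).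
apply: (squeeze_cvgr _ c0 (cvg_cst (1 : R))).
apply: nearW => m.
have zm : 0 <= z ^+ m <= 1 by rewrite exprn_ge0 ?exprn_ile1//; lra.
rewrite cutoff_le1 ?andbT; last by lra.
by have := bernoulli_expr_ge (2 ^ m) zm; rewrite natrX exprMn.
Qed.

Section cutoff_integral.
Variable f : R -> R.
Hypothesis fi : mu.-integrable `[0, +oo[ (EFin \o f).
Hypothesis f0 : forall a : R, 0 <= a ->
  \int[mu]_(t in `[0, +oo[) (expR (- (a * t)) * f t) = 0.

Let weighted_expr_integrable (a : R) n (c : R) : 0 <= a -> 0 <= c ->
  mu.-integrable `[0, +oo[
    (EFin \o (fun t => expR (- (c * t)) * (1 - expR (- (a * t))) ^+ n * f t)).
Proof.
move=> a0 c0.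
have mf := integrable_measurable_fun fi.
have me (d : R) : measurable_fun `[(0 : R), +oo[ (fun t => expR (- (d * t))).
  apply: measurableT_comp => //.
  by apply: measurableT_comp => //; exact: measurable_funM.
apply: (@integrable_le_norm _ _ _ (fun x => `|f x|)) => //.
- apply: measurable_funM => //; apply: measurable_funM => //.
  by apply: measurable_funX; apply: measurable_funB.
- exact: integrable_norm.
move=> x /=; rewrite in_itv/= andbT => x0.
have e01 d : 0 <= d -> 0 <= expR (- (d * x)) <= 1.
  by move=> d0; rewrite expR_ge0 expR_le1 oppr_le0 mulr_ge0.
have /andP[ea0 ea1] := e01 _ a0; have /andP[ec0 ec1] := e01 _ c0.
rewrite normrM ler_piMl// normrM mulr_ile1// ?ger0_norm//.
  by rewrite exprn_ile1// ?subr_ge0// lerBlDr lerDl.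
by rewrite exprn_ge0// subr_ge0.
Qed.

Let weighted_expr_integral0 (a : R) n (c : R) : 0 <= a -> 0 <= c ->
  \int[mu]_(t in `[0, +oo[)
     (expR (- (c * t)) * (1 - expR (- (a * t))) ^+ n * f t) = 0.
Proof.
move=> a0; elim: n c => [|n IH] c c0.
  rewrite -[RHS](f0 c0); apply: eq_Rintegral => t _.
  by rewrite expr0 mulr1.
transitivity (\int[mu]_(t in `[0, +oo[)
   (expR (- (c * t)) * (1 - expR (- (a * t))) ^+ n * f t
  - expR (- ((c + a) * t)) * (1 - expR (- (a * t))) ^+ n * f t)).
  apply: eq_Rintegral => t _.
  by rewrite mulrDl opprD expRD exprS; ring.
rewrite RintegralB//; try apply: weighted_expr_integrable; rewrite ?addr_ge0//.
by rewrite !IH ?addr_ge0// subr0.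
Qed.

(** With [a] such that [exp (- a T) = 1/2], the functions
    [(1 - exp (- m a t)) ^ (2 ^ m)] are combinations of exponentials, so [f]
    integrates to 0 against them, and they converge boundedly, except at
    [t = T], to the indicator function of [t > T]. *)
Lemma integral_itv_from_exponentials (T : R) : 0 < T ->
  \int[mu]_(t in `[0, T]) f t = 0.
Proof.
move=> T0.
have mf := integrable_measurable_fun fi.
pose a := ln 2 / T.
have a0 : 0 < a by rewrite divr_gt0// ln_gt0// ltr1n.
have aT : a * T = ln 2 by rewrite /a divfK// gt_eqF.
have e2 : expR (- (a * T)) = 2^-1 by rewrite aT -lnV ?posrE// lnK// posrE.
pose F m t := cutoff m (expR (- (a * t))) * f t.
have e01 x : 0 <= x -> 0 <= expR (- (a * x)) <= 1.
  by move=> x0; rewrite expR_ge0 expR_le1 oppr_le0 mulr_ge0// ltW.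
have FE m : \int[mu]_(t in `[0, +oo[) F m t = 0.
  rewrite -[RHS](@weighted_expr_integral0 (a * m%:R) (2 ^ m) 0)//; last first.
    by rewrite mulr_ge0// ltW.
  apply: eq_Rintegral => t _; rewrite /F /cutoff mul0r oppr0 expR0 mul1r.
  by rewrite -expRM_natr; congr ((1 - expR _) ^+ _ * _); ring.
have me : measurable_fun `[(0 : R), +oo[ (fun t => expR (- (a * t))).
  apply: measurableT_comp => //.
  by apply: measurableT_comp => //; exact: measurable_funM.
pose G : R -> R := f \_ `]T, +oo[.
have mG : measurable_fun `[(0 : R), +oo[ G.
  apply: (@measurable_funS _ _ _ _ setT) => //.
  apply/(measurable_restrictT _ _).1 => //.
  by apply: measurable_funS mf => //; apply: subset_itvr; rewrite bnd_simp ltW.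
have FG : \int[mu]_(t in `[0, +oo[) F m t @[m --> \oo] -->
          \int[mu]_(t in `[0, +oo[) G t.
  apply: (@Rintegral_dominated_cvg _ _ F G (fun t => `|f t|)) => //.
  - move=> m; apply: measurable_funM => //.
    apply: measurable_funX; apply: measurable_funB => //.
    exact: measurable_funX.
  - exists [set T]; split => //; first exact: lebesgue_measure_set1.
    move=> t /= /not_implyP[]; rewrite in_itv/= andbT => t0 h.
    apply: contra_notP h => /eqP tT.
    rewrite /G patchE.
    have [Tt|tT'|tTeq] := ltgtP T t.
    - rewrite mem_set/= ?in_itv/= ?Tt//.
      rewrite -[X in _ --> X]mul1r; apply: cvgM; last exact: cvg_cst.
      apply: cutoff_cvg1; rewrite expR_gt0/= -e2 ltr_expR ltrN2.
      by rewrite ltr_pM2l.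
    - rewrite memNset/=; last first.
        by rewrite in_itv/= andbT; apply/negP; rewrite -leNgt ltW.
      rewrite -[X in _ --> X](mul0r (f t)); apply: cvgM; last exact: cvg_cst.
      apply: cutoff_cvg0; rewrite -e2 ltr_expR ltrN2 ltr_pM2l// tT'/=.
      by have /andP[] := e01 _ t0.
    - by rewrite tTeq eqxx in tT.
  - exact: integrable_norm.
  - move=> m x /=; rewrite in_itv/= andbT => x0.
    rewrite normrM ler_piMl// ger0_norm ?cutoff_le1 ?cutoff_ge0//; exact: e01.
have G0 : \int[mu]_(t in `[0, +oo[) G t = 0.
  apply: (cvg_unique _ FG) => //.
  rewrite /= (_ : (fun m => \int[mu]_(t in `[0, +oo[) F m t) = cst 0).
    exact: cvg_cst.
  exact/funext.
have ft0 : \int[mu]_(t in `[0, +oo[) f t = 0.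
  rewrite -[RHS](f0 (lexx 0)); apply: eq_Rintegral => t _.
  by rewrite mul0r oppr0 expR0 mul1r.
have := Rintegral_itvB fi (x := T) _ _; rewrite !bnd_simp (ltW T0).
move=> /(_ isT isT); rewrite ft0.
have -> : \int[mu]_(t in `]T, +oo[) f t = 0.
  rewrite -[RHS]G0 -Rintegral_mkcondr setIidr//.
  by apply: subset_itvr; rewrite bnd_simp ltW.
by rewrite sub0r => /eqP; rewrite oppr_eq0 => /eqP.
Qed.

End cutoff_integral.

(** By Lebesgue differentiation [f] is almost everywhere the derivative of its
    primitive, which vanishes here. *)
Lemma ae_eq0_itv_integral (f : R -> R) :
  mu.-integrable `[0, +oo[ (EFin \o f) ->
  (forall T, 0 < T -> \int[mu]_(t in `[0, T]) f t = 0) ->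
  {ae mu, forall t, 0 <= t -> f t = 0}.
Proof.
move=> fi f0.
pose g : R -> R := f \_ `[0, +oo[.
have gi : mu.-integrable setT (EFin \o g).
  by rewrite /g -restrict_EFin -integrable_mkcond.
have gi' (D : set R) : measurable D -> mu.-integrable D (EFin \o g).
  by move=> mD; apply: integrableS gi.
have g0 T : 0 < T -> \int[mu]_(t in `[0, T]) g t = 0.
  move=> T0; rewrite -[RHS](f0 _ T0); apply: eq_Rintegral => t.
  rewrite inE/= in_itv/= => /andP[t0 _].
  by rewrite /g patchE mem_set//= in_itv/= t0.
have lg : locally_integrable [set: R] g by exact: integrable_locally.
have h := FTC1 (a := BLeft 0) (fun y => gi' _ (measurable_itv _)) lg.
have ae0 : {ae mu, forall t : R, t <> 0}.
  exists [set 0]; split => //; first exact: lebesgue_measure_set1.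
  by move=> t /= /contrapT.
apply: filterS2 ae0 h => [|t /eqP t0 ht tge0].
  exact: (ae_filter_ringOfSetsType mu).
have tp : 0 < t by rewrite lt_neqAle eq_sym t0.
have -> : f t = g t by rewrite /g patchE mem_set//= in_itv/= tge0.
have [|_ <-] := ht; first by rewrite lte_fin.
rewrite derive1E; transitivity ('D_1 (cst 0 : R -> R) t); last exact: derive_cst.
apply: near_eq_derive; near=> x; rewrite g0//.
by near: x; exact: lt_nbhsr.
Unshelve. all: by end_near. Qed.

(** Lerch's theorem. Absorbing one exponential into [f] makes it integrable and
    leaves all nonnegative real exponents available. *)
Lemma laplace_injective (f : R -> R) (s : R) :
  (forall x, s < x ->
     mu.-integrable `[0, +oo[ (EFin \o (fun t => expR (- (x * t)) * f t)) /\
     \int[mu]_(t in `[0, +oo[) (expR (- (x * t)) * f t) = 0) ->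
  {ae mu, forall t, 0 <= t -> f t = 0}.
Proof.
move=> fs.
have s1 : s < s + 1 by rewrite ltrDl.
have [fi _] := fs _ s1.
have : {ae mu, forall t, 0 <= t -> expR (- ((s + 1) * t)) * f t = 0}.
  apply: ae_eq0_itv_integral => // T T0.
  apply: integral_itv_from_exponentials => // a a0.
  have [_ h] := fs (s + 1 + a) (ltr_wpDr a0 s1).
  rewrite -[RHS]h.
  by apply: eq_Rintegral => t _; rewrite mulrA -expRD; congr (expR _ * _); ring.
apply: filterS => [|t + t0]; first exact: (ae_filter_ringOfSetsType mu).
by move=> /(_ t0) /eqP; rewrite mulf_eq0 expR_eq0 => /eqP.
Qed.

End lerch.

(** * The Laplace transform of the kernel *)

Section kernel.
Context {R : realType}.
Local Notation mu := (@lebesgue_measure R).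

(** Integrate the derivative over [-n, n] and let [n] tend to infinity. *)
Lemma integral_derivative_eq0 (g D : R -> R) :
  (forall u : R, is_derive u 1 g (D u)) -> continuous D ->
  mu.-integrable setT (EFin \o D) ->
  g n%:R @[n --> \oo] --> (0 : R) -> g (- n%:R) @[n --> \oo] --> (0 : R) ->
  \int[mu]_u D u = 0.
Proof.
move=> gD cD iD g1 g2.
have cg : continuous g.
  move=> u; apply: differentiable_continuous; apply/derivable1_diffP.
  by have [] := gD u.
have DE n : (0 < n)%N ->
    \int[mu]_(u in `[- n%:R, n%:R]) D u = g n%:R - g (- n%:R).
  move=> n0; have n0R : 0 < n%:R :> R by rewrite ltr0n.
  rewrite /Rintegral (@continuous_FTC2 _ D g) //.
  - by rewrite (lt_trans _ n0R)// oppr_lt0.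
  - exact: continuous_subspaceT.
  - split.
    + by move=> x _; have [] := gD x.
    + exact/cvg_at_right_filter/cg.
    + exact/cvg_at_left_filter/cg.
  - by move=> x _; rewrite derive1E; have [_ ->] := gD x.
have mD : measurable_fun setT D by exact: continuous_measurable_fun.
have c1 : \int[mu]_(u in `[- n%:R, n%:R]) D u @[n --> \oo] --> \int[mu]_u D u.
  under eq_fun do rewrite Rintegral_mkcond.
  apply: (@Rintegral_dominated_cvg _ _ (fun n => D \_ `[- n%:R, n%:R]) _
      (fun u => `|D u|)) => //.
  - move=> n; apply/(measurable_restrictT _ _).1 => //.
    exact: measurable_funTS.
  - apply: aeW => u _; apply: cvg_near_cst; near=> n.
    rewrite patchE mem_set//= in_itv/= -ler_norml.
    by near: n; exact: nbhs_infty_ger.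
  - exact: integrable_norm.
  - by move=> n x _; rewrite patchE; case: ifPn => // _; rewrite normr0.
have c2 : \int[mu]_(u in `[- n%:R, n%:R]) D u @[n --> \oo] --> 0 - 0.
  apply: cvg_trans (cvgB g1 g2).
  apply: near_eq_cvg; near=> n; rewrite DE//.
  by near: n; exact: nbhs_infty_gt.
by rewrite (cvg_unique _ c1 c2)// subr0.
Unshelve. all: by end_near. Qed.

(** Comparison with a Gaussian: [x u^4 - u^2 + 1/(4x)] is a square. *)
Lemma quartic_exp_integrable (x : R) : 0 < x ->
  mu.-integrable setT (EFin \o (fun u => expR (- (x * u ^+ 4)))).
Proof.
move=> x0.
apply: (@integrable_le_norm _ _ _ (fun u => expR (4 * x)^-1 * gauss_fun u)) => //.
- apply: measurableT_comp => //; apply: measurableT_comp => //.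
  by apply: measurable_funM => //; exact: measurable_funX.
- exact: (integrableZl measurableT (expR (4 * x)^-1) integrableT_gauss).
move=> u _; rewrite ger0_norm ?expR_ge0// /gauss_fun -expRD ler_expR.
rewrite -subr_ge0 (_ : _ - _ = x * (u ^+ 2 - (2 * x)^-1) ^+ 2).
  by rewrite mulr_ge0 ?sqr_ge0// ltW.
by field; rewrite gt_eqF.
Qed.

(** Write [m = la + i th] and [p s = exp (s m)], a path from [1] to
    [exp m] in the complex plane. The integral over [u] of
    [exp (s m / 4) * exp (- p s * u^4)] does not depend on [s]: formally this is
    the substitution [u -> exp (- s m / 4) u], a rotation of the line of
    integration. It is proved by differentiating in [s], because the
    [s]-derivative of the integrand is also a [u]-derivative. To stay with real
    integrals, only the real part of [exp (- i phi)] times the integrand is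
    considered, for an arbitrary phase [phi]. *)
Section path.
Variables la th phi : R.

(** The real and the imaginary part of [p s]. *)
Definition pathX (s : R) := expR (s * la) * cos (s * th).
Definition pathY (s : R) := expR (s * la) * sin (s * th).

Let E (s u : R) := expR (s * (la / 4) - pathX s * u ^+ 4).
Let psi (s u : R) := pathY s * u ^+ 4 - s * (th / 4) + phi.

(** The real part of [exp (- i phi) * exp (s m / 4) * exp (- p s * u^4)]. *)
Definition pathF (s u : R) : R := E s u * cos (psi s u).

(** The common value of the [s]-derivative of the integrand and of the
    [u]-derivative of the function that follows. *)
Definition pathD (s u : R) : R := E s u *
  ((la / 4 - (la * pathX s - th * pathY s) * u ^+ 4) * cos (psi s u)
 - ((la * pathY s + th * pathX s) * u ^+ 4 - th / 4) * sin (psi s u)).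

(** The real part of [exp (- i phi) * (m / 4) * u * exp (s m / 4 - p s * u^4)]. *)
Definition pathG (s u : R) : R :=
  4^-1 * (u * (E s u * (la * cos (psi s u) + th * sin (psi s u)))).

Lemma is_derive_pathF (s u : R) :
  is_derive s (1 : R) (fun s : R => pathF s u) (pathD s u).
Proof.
rewrite /pathF /pathD /E /psi /pathX /pathY.
apply: is_derive_eq.
rewrite /GRing.scale/=.
by ring.
Qed.

Lemma is_derive_pathG (s u : R) :
  is_derive u (1 : R) (fun u : R => pathG s u) (pathD s u).
Proof.
rewrite /pathG /pathD /E /psi.
apply: is_derive_eq.
rewrite /GRing.scale/=.
by field.
Qed.

Lemma continuous_pathD (s : R) : continuous (pathD s : R -> R).
Proof.
move=> u; apply: differentiable_continuous; apply/derivable1_diffP.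
rewrite /pathD /E /psi; exact: ex_derive.
Qed.

Lemma continuous_pathF (s : R) : continuous (pathF s : R -> R).
Proof.
move=> u; apply: differentiable_continuous; apply/derivable1_diffP.
rewrite /pathF /E /psi; exact: ex_derive.
Qed.

Let M : R := expR (2 * `|la|).
Let L : R := `|la| + `|th|.

Let M_gt0 : 0 < M. Proof. exact: expR_gt0. Qed.

Let L_ge0 : 0 <= L. Proof. exact: addr_ge0. Qed.

Let expR_le_M (s a : R) : `|s| <= 2 -> `|a| <= `|la| -> expR (s * a) <= M.
Proof.
move=> s2 ala; rewrite ler_expR (le_trans (ler_norm _))// normrM.
exact: ler_pM.
Qed.

Let E_le (s u x0 : R) : `|s| <= 2 -> x0 <= pathX s ->
  0 <= E s u <= M * expR (- (x0 * u ^+ 4)).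
Proof.
move=> s2 xs; rewrite expR_ge0/= /E expRD ler_pM ?expR_ge0//.
  apply: expR_le_M => //; rewrite normrM [`|4^-1|]ger0_norm// ler_piMr//.
  by rewrite invf_le1// ler1n.
by rewrite ler_expR lerN2 ler_wpM2r// exprn_even_ge0.
Qed.

Let path_le (s : R) : `|s| <= 2 -> `|pathX s| <= M /\ `|pathY s| <= M.
Proof.
move=> s2.
have e1 : expR (s * la) <= M by exact: expR_le_M.
by rewrite /pathX /pathY !normrM !(ger0_norm (expR_ge0 _)); split;
  rewrite -[leRHS]mulr1 ler_pM ?expR_ge0// ?cos_max ?sin_max.
Qed.

Let pathF_le (s u x0 : R) : `|s| <= 2 -> x0 <= pathX s ->
  `|pathF s u| <= M * expR (- (x0 * u ^+ 4)).
Proof.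
move=> s2 xs; have /andP[E0 EM] := E_le u s2 xs.
by rewrite /pathF normrM (ger0_norm E0) -[leRHS]mulr1 ler_pM// cos_max.
Qed.

(** Half of the exponential decay absorbs the factor [u^4]. *)
Let pathD_le (s u x0 : R) : `|s| <= 2 -> 0 < x0 -> x0 <= pathX s ->
  `|pathD s u| <= 2 * M * L * (1 + M * (2 / x0)) * expR (- (x0 / 2 * u ^+ 4)).
Proof.
move=> s2 x00 xs; have /andP[E0 EM] := E_le u s2 xs.
have [X1 Y1] := path_le s2.
have u0 : 0 <= u ^+ 4 by rewrite exprn_even_ge0.
have P1 : `|la / 4 - (la * pathX s - th * pathY s) * u ^+ 4|
    <= L * (1 + M * u ^+ 4).
  rewrite (le_trans (ler_normB _ _))// mulrDr mulr1 lerD//.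
    rewrite normrM [`|4^-1|]ger0_norm// /L.
    by have := normr_ge0 la; have := normr_ge0 th; lra.
  rewrite normrM (ger0_norm u0) mulrA ler_wpM2r//.
  rewrite (le_trans (ler_normB _ _))// /L mulrDl (normrM la) (normrM th).
  by rewrite lerD// ler_wpM2l.
have P2 : `|(la * pathY s + th * pathX s) * u ^+ 4 - th / 4|
    <= L * (1 + M * u ^+ 4).
  rewrite (le_trans (ler_normB _ _))// mulrDr mulr1 [leRHS]addrC lerD//.
    rewrite normrM (ger0_norm u0) mulrA ler_wpM2r//.
    rewrite (le_trans (ler_normD _ _))// /L mulrDl (normrM la) (normrM th).
    by rewrite lerD// ler_wpM2l.
  rewrite normrM [`|4^-1|]ger0_norm// /L.
  by have := normr_ge0 la; have := normr_ge0 th; lra.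
have : `|pathD s u| <= M * expR (- (x0 * u ^+ 4)) * (2 * (L * (1 + M * u ^+ 4))).
  rewrite /pathD normrM (ger0_norm E0) ler_pM//.
  rewrite (le_trans (ler_normB _ _))// mulr_natl mulr2n lerD// normrM.
    by rewrite -[leRHS]mulr1 ler_pM// cos_max.
  by rewrite -[leRHS]mulr1 ler_pM// sin_max.
move=> /le_trans; apply.
have -> : expR (- (x0 * u ^+ 4))
    = expR (- (x0 / 2 * u ^+ 4)) * expR (- (x0 / 2 * u ^+ 4)).
  by rewrite -expRD; congr expR; field.
set e := expR (- (x0 / 2 * u ^+ 4)).
have e0 : 0 < e by exact: expR_gt0.
have e1 : e <= 1.
  by rewrite expR_le1 oppr_le0 mulr_ge0// divr_ge0// ltW.
have eu : u ^+ 4 * e <= 2 / x0.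
  have : e * (1 + x0 / 2 * u ^+ 4) <= 1.
    by rewrite mulrC -ler_pdivlMr// div1r /e expRN invrK expR_ge1Dx.
  by rewrite ler_pdivlMr// => h; lra.
rewrite [leLHS](_ : _ = 2 * M * L * e * (e + M * (u ^+ 4 * e))); last by ring.
rewrite [leRHS](_ : _ = 2 * M * L * e * (1 + M * (2 / x0))); last by ring.
rewrite ler_wpM2l//.
  by rewrite !mulr_ge0// ltW.
by rewrite lerD// ler_wpM2l// ltW.
Qed.

Let pathG_le (s u x0 : R) : `|s| <= 2 -> 0 < x0 -> x0 <= pathX s ->
  `|pathG s u| <= `|u| * (M * expR (- (x0 * u ^+ 4)) * L).
Proof.
move=> s2 x00 xs; have /andP[E0 EM] := E_le u s2 xs.
rewrite /pathG normrM -[leRHS]mul1r ler_pM//.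
  by rewrite ger0_norm// invf_le1// ler1n.
rewrite normrM ler_wpM2l// normrM (ger0_norm E0) ler_pM//.
rewrite (le_trans (ler_normD _ _))// /L !normrM.
by rewrite lerD// ler_piMr// ?cos_max ?sin_max.
Qed.

Let pathG_cvg0 (s x0 e : R) : `|s| <= 2 -> 0 < x0 -> x0 <= pathX s ->
  `|e| = 1 -> pathG s (e * n%:R) @[n --> \oo] --> (0 : R).
Proof.
move=> s2 x00 xs e1.
apply: norm_cvg0.
have c0 : (M * L * (2 / x0)) * harmonic n @[n --> \oo] --> (0 : R).
  rewrite -[X in _ --> X](mulr0 (M * L * (2 / x0))); apply: cvgMr.
  exact: cvg_harmonic.
apply: (squeeze_cvgr _ (cvg_cst (0 : R)) c0).
apply: nearW => n; rewrite normr_ge0/=.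
apply: le_trans (pathG_le _ s2 x00 xs) _.
have -> : (e * n%:R) ^+ 4 = n%:R ^+ 4 :> R.
  rewrite exprMn -(@ger0_norm _ (e ^+ 4)) ?exprn_even_ge0//.
  by rewrite normrX e1 expr1n mul1r.
rewrite normrM e1 mul1r ger0_norm//.
rewrite [leLHS](_ : _ = M * L * (n%:R * expR (- (x0 * n%:R ^+ 4)))); last by ring.
rewrite -[leRHS]mulrA ler_wpM2l ?mulr_ge0// ?(ltW M_gt0)//.
rewrite ler_pdivlMr ?ltr0n// mulrAC expRN ler_pdivrMr ?expR_gt0//.
apply: (@le_trans _ _ (2 / x0 * (x0 * n%:R ^+ 4))); last first.
  rewrite ler_wpM2l// ?divr_ge0// ?ltW//.
  by apply: lt_le_trans (expR_ge1Dx _); rewrite ltrDr.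
rewrite [leRHS]mulrA divfK ?gt_eqF// -natrX -!natrM ler_nat.
by case: n => // n; rewrite !expnS expn0; nia.
Qed.

Definition pathI (s : R) : R := \int[mu]_u pathF s u.

(** The [s]-derivative is the integral of a [u]-derivative of a function that
    vanishes at infinity. *)
Lemma pathI_const : `|th| < pi / 2 -> pathI 1 = pathI 0.
Proof.
move=> thpi.
have pi0 := @pi_gt0 R.
(* The interval is slightly larger than [-1, 1], so that the end points are
   interior, and so small that the path stays in the right half-plane. *)
pose eps : R := (pi / 2 - `|th|) / pi.
have eps0 : 0 < eps by rewrite divr_gt0// subr_gt0.
have eps1 : eps <= 1.
  by rewrite ler_pdivrMr// mul1r; have := normr_ge0 th; lra.
pose eta := (1 + eps) * `|th|.
have etapi : 0 <= eta < pi / 2.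
  rewrite mulr_ge0 ?addr_ge0 ?(ltW eps0)//= /eta.
  have : eps * `|th| <= eps * (pi / 2) by rewrite ler_wpM2l// ltW.
  have : eps * (pi / 2) = (pi / 2 - `|th|) / 2.
    by rewrite /eps mulrA divfK ?gt_eqF.
  lra.
pose x0 := expR (- (2 * `|la|)) * cos eta.
have x00 : 0 < x0.
  by rewrite mulr_gt0 ?expR_gt0// cos_gt0_pihalf//; lra.
pose I : set R := `](- (1 + eps)), (1 + eps)[%classic.
have I2 s : I s -> `|s| <= 2.
  rewrite /I/= in_itv/= => /andP[s1 s2].
  by rewrite ler_norml; lra.
have Ix s : I s -> x0 <= pathX s.
  move=> Is; have := Is; rewrite /I/= in_itv/= -ltr_norml => s1.
  rewrite /x0 /pathX ler_pM ?expR_ge0//.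
  - by rewrite ltW// cos_gt0_pihalf//; lra.
  - rewrite ler_expR lerNl -mulNr (le_trans (ler_norm _))// normrM normrN.
    by rewrite ler_wpM2r// I2.
  - rewrite -(cos_norm (s * th)) normrM.
    have sth : `|s| * `|th| <= eta by rewrite ler_wpM2r// ltW.
    have [->//|ne] := eqVneq (`|s| * `|th|) eta.
    rewrite ltW// ltr_cos ?in_itv/=.
    + by rewrite lt_neqAle ne.
    + by rewrite mulr_ge0//=; lra.
    + by case/andP: etapi => -> ?/=; lra.
have iF s : I s -> mu.-integrable setT (EFin \o pathF s).
  move=> Is; apply: (@integrable_le_norm _ _ _
      (fun u => M * expR (- (x0 * u ^+ 4)))) => //.
  - by apply: continuous_measurable_fun; exact: continuous_pathF.
  - exact: (integrableZl measurableT M (quartic_exp_integrable x00)).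
  - by move=> u _; apply: pathF_le; [exact: I2|exact: Ix].
pose K := 2 * M * L * (1 + M * (2 / x0)).
pose B u := K * expR (- (x0 / 2 * u ^+ 4)).
have iB : mu.-integrable setT (EFin \o B).
  apply: (integrableZl measurableT K (quartic_exp_integrable _)).
  by rewrite divr_gt0.
have dF (s u : R) : 'D_1 (fun s : R => pathF s u) s = pathD s u.
  by have [_ ->] := is_derive_pathF s u.
have iD s : I s -> mu.-integrable setT (EFin \o pathD s).
  move=> Is; apply: (@integrable_le_norm _ _ _ B) => //.
  - by apply: continuous_measurable_fun; exact: continuous_pathD.
  - by move=> u _; apply: pathD_le => //; [exact: I2|exact: Ix].
have D0 s : I s -> \int[mu]_u pathD s u = 0.
  move=> Is; apply: (@integral_derivative_eq0 (pathG s)) => //.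
  - exact: is_derive_pathG.
  - exact: continuous_pathD.
  - exact: iD.
  - under eq_cvg do rewrite -[_%:R]mul1r.
    by apply: (pathG_cvg0 (I2 _ Is) x00 (Ix _ Is)); rewrite normr1.
  - under eq_cvg do rewrite -mulN1r.
    by apply: (pathG_cvg0 (I2 _ Is) x00 (Ix _ Is)); rewrite normrN1.
have dI s : I s -> is_derive s (1 : R) pathI (0 : R).
  move=> Is.
  have B_ge0 y : 0 <= B y.
    rewrite mulr_ge0 ?expR_ge0// !mulr_ge0// ?(ltW M_gt0)//.
    by rewrite addr_ge0// mulr_ge0 ?(ltW M_gt0)// divr_ge0// ltW.
  have derF x y : I x -> setT y -> derivable (fun s : R => pathF s y) x 1.
    by move=> _ _; have [] := is_derive_pathF x y.
  have ub x y : I x -> setT y -> `|partial1of2 pathF x y| <= B y.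
    move=> Ix' _; rewrite partial1of2E dF.
    by apply: pathD_le => //; [exact: I2|exact: Ix].
  apply: DeriveDef.
    exact: (@derivable_under_integral R _ _ mu pathF setT measurableT s _ _ Is
       iF derF B B_ge0 iB ub).
  rewrite -derive1E (@differentiation_under_integral R _ _ mu pathF setT
     measurableT s _ _ Is iF derF B B_ge0 iB ub) -[RHS](D0 s Is).
  by apply: eq_Rintegral => u _; rewrite partial1of2E dF.
have I01 s : 0 <= s <= 1 -> I s by rewrite /I/= in_itv/=; lra.
have dI01 (s : R) : s \in `]0, 1[%R -> is_derive s (1 : R) pathI (cst (0 : R) s).
  by rewrite in_itv/= => /andP[s0 s1]; apply/dI/I01; rewrite !ltW.
have cI01 : {within `[(0 : R), 1], continuous pathI}.
  apply: derivable_within_continuous => s; rewrite in_itv/= => s01.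
  by have [] := dI s (I01 _ s01).
have [c _ /eqP] := MVT_segment ler01 dI01 cI01.
by rewrite /cst/= mul0r subr_eq0 => /eqP.
Qed.

End path.
Lemma quartic_exp_integrableM (x : R) (h : R -> R) : 0 < x ->
  measurable_fun setT h -> (forall z, `|h z| <= 1) ->
  mu.-integrable setT (EFin \o (fun u => expR (- (x * u ^+ 4)) * h u)).
Proof.
move=> x0 mh h1; have ie := quartic_exp_integrable x0.
apply: (integrable_le_norm _ _ ie) => //.
  by apply: measurable_funM => //; exact: integrable_measurable_fun ie.
move=> u _; rewrite normrM ger0_norm ?expR_ge0// -[leRHS]mulr1.
by rewrite ler_wpM2l ?expR_ge0.
Qed.

Lemma measurable_quartic (y : R) : measurable_fun [set: R] (fun u => y * u ^+ 4).
Proof. by apply: measurable_funM => //; exact: measurable_funX. Qed.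

Lemma quartic_exp_cos_integrable (x y : R) : 0 < x ->
  mu.-integrable setT
    (EFin \o (fun u => expR (- (x * u ^+ 4)) * cos (y * u ^+ 4))).
Proof.
move=> x0; apply: quartic_exp_integrableM => // [|z]; last exact: cos_max.
apply: measurableT_comp; last exact: measurable_quartic.
by apply: continuous_measurable_fun; exact: continuous_cos.
Qed.

Lemma quartic_exp_sin_integrable (x y : R) : 0 < x ->
  mu.-integrable setT
    (EFin \o (fun u => expR (- (x * u ^+ 4)) * sin (y * u ^+ 4))).
Proof.
move=> x0; apply: quartic_exp_integrableM => // [|z]; last exact: sin_max.
apply: measurableT_comp; last exact: measurable_quartic.
by apply: continuous_measurable_fun; exact: continuous_sin.
Qed.

(** The integral of [exp (- p u^4)] over the real line, at [p = 1] and at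
    [p = x + i y]; in the second case its real part and minus its imaginary
    part. *)
Definition quartic_mass : R := \int[mu]_u expR (- u ^+ 4).
Definition quartic_cos (x y : R) : R :=
  \int[mu]_u (expR (- (x * u ^+ 4)) * cos (y * u ^+ 4)).
Definition quartic_sin (x y : R) : R :=
  \int[mu]_u (expR (- (x * u ^+ 4)) * sin (y * u ^+ 4)).

(** The Laplace transform of [t^(-3/4)], as a multiple of [p^(-1/4)], at the
    point [p = x + i y] of polar coordinates [exp la] and [th]. The two
    identities are the real part and, up to sign, the imaginary part of
    [p^(1/4) * (quartic_cos - i quartic_sin) = quartic_mass]. *)
Lemma quartic_laplace (la th : R) : `|th| < pi / 2 ->
  let x := expR la * cos th in let y := expR la * sin th in
  expR (la / 4) * (cos (th / 4) * quartic_cos x y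
                 + sin (th / 4) * quartic_sin x y) = quartic_mass /\
  expR (la / 4) * (cos (th / 4) * quartic_sin x y
                 - sin (th / 4) * quartic_cos x y) = 0.
Proof.
move=> thpi x y.
have x0 : 0 < x.
  by rewrite mulr_gt0 ?expR_gt0// cos_gt0_pihalf// -ltr_norml.
have ic := quartic_exp_cos_integrable y x0.
have js := quartic_exp_sin_integrable y x0.
have Xx : pathX la th 1 = x by rewrite /pathX !mul1r.
have Yy : pathY la th 1 = y by rewrite /pathY !mul1r.
have X0 : pathX la th 0 = 1 by rewrite /pathX !mul0r expR0 cos0 mul1r.
have Y0 : pathY la th 0 = 0 by rewrite /pathY !mul0r sin0 mulr0.
have lin (a b : R) :
    \int[mu]_u (a * (expR (- (x * u ^+ 4)) * cos (y * u ^+ 4))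
              + b * (expR (- (x * u ^+ 4)) * sin (y * u ^+ 4)))
    = a * quartic_cos x y + b * quartic_sin x y.
  rewrite RintegralD//; last 2 first.
  - exact: (integrableZl measurableT a ic).
  - exact: (integrableZl measurableT b js).
  by rewrite !RintegralZl.
split.
- have := pathI_const la 0 thpi; rewrite /pathI.
  rewrite [X in X = _ -> _](_ : _ = \int[mu]_u
     (expR (la / 4) * cos (th / 4) * (expR (- (x * u ^+ 4)) * cos (y * u ^+ 4))
    + expR (la / 4) * sin (th / 4) * (expR (- (x * u ^+ 4)) * sin (y * u ^+ 4)))).
    rewrite lin mulrDr !mulrA => ->.
    apply: eq_Rintegral => u _; rewrite /pathF X0 Y0 !mul0r subr0 addr0 cos0.
    by rewrite mulr1 sub0r mul1r.
  apply: eq_Rintegral => u _; rewrite /pathF Xx Yy !mul1r addr0 cosB expRD.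
  by ring.
(* The phase [- pi / 2] selects the imaginary part, up to sign. *)
- have := pathI_const la (- (pi / 2)) thpi; rewrite /pathI.
  rewrite [X in X = _ -> _](_ : _ = \int[mu]_u
    (- (expR (la / 4) * sin (th / 4)) * (expR (- (x * u ^+ 4)) * cos (y * u ^+ 4))
    + expR (la / 4) * cos (th / 4) * (expR (- (x * u ^+ 4)) * sin (y * u ^+ 4)))).
    rewrite lin mulrBr mulNr addrC !mulrA => ->.
    rewrite /Rintegral integral0_eq//= => u _.
    by rewrite /pathF Y0 cosBpihalf !mul0r subrr sin0 mulr0.
  apply: eq_Rintegral => u _.
  by rewrite /pathF Xx Yy !mul1r cosBpihalf sinB expRD; ring.
Qed.

Lemma quartic_mass_gt0 : 0 < quartic_mass.
Proof.
apply: (@lt_le_trans _ _ (expR (- 1))); first exact: expR_gt0.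
pose h : R -> R := (cst (expR (- 1)) : R -> R) \_ `[0, 1].
have -> : expR (- 1) = \int[mu]_t h t.
  rewrite /h -Rintegral_mkcond Rintegral_cst//= lebesgue_measure_itv//=.
  by rewrite lte01 oppr0 addr0 mulr1.
have ie : mu.-integrable setT (EFin \o (fun u : R => expR (- u ^+ 4))).
  have := quartic_exp_integrable (@ltr01 R); apply: eq_integrable => // u _.
  by rewrite /= mul1r.
apply: le_Rintegral => //.
  have i01 : mu.-integrable `[0, 1] (EFin \o (cst (expR (- 1)) : R -> R)).
    apply: continuous_compact_integrable; first exact: segment_compact.
    by apply: continuous_subspaceT => z; exact: cvg_cst.
  by rewrite /h -restrict_EFin -integrable_mkcond.
move=> u _; rewrite /h patchE; case: ifPn => [|_]; last exact: expR_ge0.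
rewrite inE/= in_itv/= => /andP[u0 u1].
by rewrite ler_expR lerN2 exprn_ile1.
Qed.

End kernel.

(** * The Gamma function at -1/4 *)

Section gamma.
Context {R : realType}.
Local Notation mu := (@lebesgue_measure R).

(** The integrals over [1/n, 1] are computed by a primitive and stay below
    [1/x]. *)
Lemma integrable_powR_itv01 (x : R) : 0 < x ->
  mu.-integrable `]0, 1] (EFin \o (fun t => t `^ (x - 1))).
Proof.
move=> x0.
have mp : measurable_fun setT (EFin \o (fun t : R => t `^ (x - 1))).
  by apply/measurable_EFinP; exact: measurable_powR.
pose F (n : nat) : set R := `[n.+1%:R^-1, 1]%classic.
have U : `]0, 1]%classic = \bigcup_n F n :> set R.
  apply/seteqP; split => t /=; rewrite in_itv/=.
    move=> /andP[t0 t1].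
    exists (Num.truncn t^-1) => //; rewrite /F/= in_itv/= t1 andbT.
    rewrite -[leRHS]invrK lef_pV2 ?posrE ?invr_gt0 ?ltr0n// ltW//.
    by rewrite truncnS_gt.
  move=> [n _]; rewrite /F/= in_itv/= => /andP[nt ->].
  by rewrite andbT (lt_le_trans _ nt).
have FE n : (\int[mu]_(t in F n) (t `^ (x - 1))%:E <= (x^-1)%:E)%E.
  case: n => [|n].
    by rewrite /F invr1 set_itv1 integral_set1 lee_fin invr_ge0 ltW.
  set a : R := n.+2%:R^-1.
  have a0 : 0 < a by rewrite invr_gt0 ltr0n.
  have dx (t : R) : 0 < t ->
      is_derive t (1 : R) (fun t => x^-1 * t `^ x) (t `^ (x - 1)).
    move=> t0; have := is_derive1_powR x t0 => h.
    apply: is_derive_eq; rewrite /GRing.scale/= mulrA mulVf ?mul1r//.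
    by rewrite gt_eqF.
  have cx (t : R) : 0 < t -> {for t, continuous (fun t => x^-1 * t `^ x)}.
    move=> t0; apply: differentiable_continuous; apply/derivable1_diffP.
    by have [] := dx t t0.
  rewrite (@continuous_FTC2 _ _ (fun t => x^-1 * t `^ x)).
  - rewrite powR1 mulr1 -EFinB lee_fin gerBl.
    by rewrite mulr_ge0 ?powR_ge0 ?invr_ge0 ?(ltW x0).
  - by rewrite invf_lt1 ?ltr0n// ltr1n.
  - apply: derivable_within_continuous => t; rewrite in_itv/= => /andP[ta _].
    by apply: derivable_powR; rewrite in_itv/= andbT (lt_le_trans a0).
  - split.
    + move=> t; rewrite in_itv/= => /andP[ta _].
      by have [] := dx t (lt_trans a0 ta).
    + exact/cvg_at_right_filter/cx.
    + exact/cvg_at_left_filter/cx.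
  - move=> t; rewrite in_itv/= => /andP[ta _]; rewrite derive1E.
    by have [_ ->] := dx t (lt_trans a0 ta).
apply/integrableP; split; first exact: measurable_funTS.
under eq_integral do rewrite /= ger0_norm ?powR_ge0//.
rewrite U; apply: (@le_lt_trans _ _ (x^-1)%:E); last exact: ltry.
have nd : nondecreasing_seq F.
  move=> m n mn; rewrite subsetEset; apply: subset_itvr; rewrite bnd_simp.
  by rewrite lef_pV2 ?posrE ?ltr0n// ler_nat.
have c : (\int[mu]_(t in F n) (t `^ (x - 1))%:E @[n --> \oo] -->
   \int[mu]_(t in \bigcup_n F n) (t `^ (x - 1))%:E)%E.
  apply: ge0_nondecreasing_set_cvg_integral => //.
  - by move=> n; exact: measurable_itv.
  - by move=> n; exact: measurable_funTS.
  - by move=> n t _; rewrite lee_fin powR_ge0.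
rewrite -(cvg_lim _ c)//; apply: lime_le; first exact: cvgP c.
exact: nearW.
Qed.

(** Finiteness has to be checked along with positivity, since the real value of
    an infinite integral is 0. *)
Lemma Gamma_integral_gt0 (x : R) : 0 < x <= 1 -> 0 < Gamma_integral x.
Proof.
move=> /andP[x0 x1]; rewrite /Gamma_integral.
pose p : R -> R := (fun t : R => t `^ (x - 1)) \_ `]0, 1].
pose g (t : R) : R := p t + exponential_pdf 1 t.
have ig : mu.-integrable `]0, +oo[ (EFin \o g).
  apply: (@integrableS _ _ _ _ setT) => //.
  have ip : mu.-integrable setT (EFin \o p).
    rewrite /p -restrict_EFin -integrable_mkcond//.
    exact: integrable_powR_itv01.
  exact: (integrableD measurableT ip (integrable_exponential_pdf ltr01)).
have mf : measurable_fun `](0 : R), +oo[ (fun t => t `^ (x - 1) * expR (- t)).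
  apply: measurable_funTS; apply: measurable_funM; first exact: measurable_powR.
  by apply: measurableT_comp.
have fi : mu.-integrable `]0, +oo[ (EFin \o (fun t => t `^ (x - 1) * expR (- t))).
  apply: (integrable_le_norm _ mf ig) => // t; rewrite /= in_itv/= andbT => t0.
  rewrite ger0_norm ?mulr_ge0 ?powR_ge0 ?expR_ge0// /g /p patchE.
  rewrite exponential_pdfE ?(ltW t0)//= mul1r mulN1r.
  case: ifPn => [_|].
    rewrite -[leLHS]addr0 lerD ?expR_ge0// ler_piMr ?powR_ge0//.
    by rewrite expR_le1 oppr_le0 ltW.
  rewrite notin_setE/= in_itv/= t0/= => /negP; rewrite -ltNge => t1.
  rewrite add0r ler_piMl ?expR_ge0//.
  by rewrite -[leRHS](powRr0 t) ler_powR ?subr_le0// ltW.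
apply: (@lt_le_trans _ _ (expR (- 1))); first exact: expR_gt0.
have -> : expR (- 1) =
    \int[mu]_(t in `]0, +oo[) ((cst (expR (- 1)) : R -> R) \_ `]0, 1]) t.
  rewrite -Rintegral_mkcondr setIidr; last by apply: subset_itvl.
  by rewrite Rintegral_cst//= lebesgue_measure_itv//= lte01 oppr0 addr0 mulr1.
apply: le_Rintegral => //.
  apply: (@integrableS _ _ _ _ setT) => //.
  rewrite -restrict_EFin -integrable_mkcond//.
  have i01 : mu.-integrable `[0, 1] (EFin \o (cst (expR (- 1)) : R -> R)).
    apply: continuous_compact_integrable; first exact: segment_compact.
    by apply: continuous_subspaceT => z; exact: cvg_cst.
  by apply: integrableS i01 => //; apply: subset_itvr; rewrite bnd_simp.
move=> t; rewrite /= in_itv/= andbT => t0; rewrite patchE.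
case: ifPn => [|_]; last by rewrite mulr_ge0 ?powR_ge0 ?expR_ge0.
rewrite inE/= in_itv/= t0/= => t1.
rewrite -[leLHS]mul1r ler_pM ?expR_ge0//.
  by rewrite -[leLHS](powRr0 t) ger_powR ?t0//; lra.
by rewrite ler_expR lerN2.
Qed.

(** [Gamma (-1/4) = Gamma (3/4) / (-1/4)]. *)
Lemma Gamma_quarter_neq0 : Gamma (- (1 / 4) : R) != 0.
Proof.
rewrite /Gamma ifF; last by apply/negbTE; rewrite -leNgt; lra.
rewrite opprK (@truncn_def _ (1 / 4) 0); last by apply/andP; split; lra.
rewrite mulf_neq0//.
  by rewrite gt_eqF// Gamma_integral_gt0//; lra.
by rewrite invr_eq0 big_ord1/=; apply/eqP; lra.
Qed.

End gamma.

(** * The Volterra equation *)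

Section volterra.
Context {R : realType}.
Local Notation mu := (@lebesgue_measure R).

(** The data of the Volterra equation, extended by 0 to negative times, jump at
    time 0 and are continuous elsewhere. *)
Definition continuous_off0 (w : R -> R) : Prop :=
  forall t : R, t != 0 -> {for t, continuous w}.

Lemma continuous_off0_measurable (w : R -> R) :
  continuous_off0 w -> measurable_fun setT w.
Proof.
move=> cw; rewrite -(setUv [set (0 : R)]).
apply/(measurable_funU _ (measurable_set1 _) (measurableC (measurable_set1 _)));
  split; first exact: measurable_fun_set1.
apply: open_continuous_measurable_fun.
  apply: closed_openC.
  exact: (accessible_closed_set1 (hausdorff_accessible (@Rhausdorff R))).
by move=> t; rewrite inE/= => /eqP; exact: cw.
Qed.

Lemma ae_quartic_neq (a : R) : {ae mu, forall u : R, u ^+ 4 != a}.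
Proof.
pose r := Num.sqrt (Num.sqrt a).
have sub : ~` [set u : R | u ^+ 4 != a] `<=` [set r; - r].
  move=> u /= /negP; rewrite negbK => /eqP ua.
  have -> : r = `|u|.
    rewrite /r -ua (_ : u ^+ 4 = (u ^+ 2) ^+ 2); last by rewrite -exprM.
    by rewrite sqrtr_sqr ger0_norm ?sqr_ge0// sqrtr_sqr.
  have [u0|u0] := ger0P u; [by left|by right; rewrite opprK].
exists [set r; - r]; split => //.
  by apply: measurableU => //.
by apply: countable_lebesgue_measure0; apply: finite_set_countable.
Qed.

Variables (sg q : R).
Hypotheses (sg0 : 0 < sg) (q0 : 0 <= q).
Hypothesis q_half : q * quartic_cos sg 0 <= 2^-1.

Let k (u : R) : R := expR (- (sg * u ^+ 4)).

Let k_integrable : mu.-integrable setT (EFin \o k).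
Proof. exact: quartic_exp_integrable. Qed.

Let q_mass : q * \int[mu]_u k u <= 2^-1.
Proof.
apply: le_trans q_half; rewrite ler_wpM2l// /quartic_cos.
rewrite le_eqVlt; apply/orP; left; apply/eqP; apply: eq_Rintegral => u _.
by rewrite mul0r cos0 mulr1.
Qed.

(** A multiple of the convolution with [t^(-3/4)], after the substitution
    [s = t - u^4] and conjugation by the weight [exp (sg t)]. The weight makes
    the operator contract the uniform norm on the whole line. *)
Definition volterra_op (w : R -> R) (t : R) : R :=
  q * \int[mu]_u (expR (- (sg * u ^+ 4)) * w (t - u ^+ 4)).

Let measurable_shift (w : R -> R) t : measurable_fun setT w ->
  measurable_fun setT (fun u : R => w (t - u ^+ 4)).
Proof.
move=> mw; apply: measurableT_comp => //; exact: measurable_funB.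
Qed.

Lemma volterra_integrable (w : R -> R) (M t : R) : measurable_fun setT w ->
  (forall t, `|w t| <= M) ->
  mu.-integrable setT
    (EFin \o (fun u => expR (- (sg * u ^+ 4)) * w (t - u ^+ 4))).
Proof.
move=> mw wM; apply: (@integrable_le_norm _ _ _ (fun u => M * k u)) => //.
- apply: measurable_funM; last exact: measurable_shift.
  exact: integrable_measurable_fun k_integrable.
- exact: (integrableZl measurableT M k_integrable).
- by move=> u _; rewrite normrM ger0_norm ?expR_ge0// mulrC ler_wpM2r ?expR_ge0.
Qed.

Lemma volterra_op_lipschitz (w1 w2 : R -> R) (M m t : R) :
  measurable_fun setT w1 -> measurable_fun setT w2 ->
  (forall t, `|w1 t| <= M) -> (forall t, `|w2 t| <= M) ->
  (forall t, `|w1 t - w2 t| <= m) ->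
  `|volterra_op w1 t - volterra_op w2 t| <= m / 2.
Proof.
move=> m1 m2 w1M w2M wm.
have m_ge0 : 0 <= m by apply: le_trans (wm 0).
rewrite /volterra_op -mulrBr normrM ger0_norm//.
rewrite -RintegralB//; try exact: (volterra_integrable _ _ w1M);
  try exact: (volterra_integrable _ _ w2M).
apply: (@le_trans _ _ (q * \int[mu]_u (m * k u))).
  rewrite ler_wpM2l//; apply: Rintegral_norm_le => //.
  - apply: measurable_funB; apply: integrable_measurable_fun.
      exact: (volterra_integrable _ _ w1M).
    exact: (volterra_integrable _ _ w2M).
  - exact: (integrableZl measurableT m k_integrable).
  - move=> u _; rewrite -mulrBr normrM ger0_norm ?expR_ge0// mulrC.
    by rewrite ler_wpM2r ?expR_ge0.
by rewrite RintegralZl// mulrCA ler_wpM2l.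
Qed.

Lemma volterra_op_le (w : R -> R) (M t : R) : measurable_fun setT w ->
  (forall t, `|w t| <= M) -> `|volterra_op w t| <= M / 2.
Proof.
move=> mw wM; have M0 : 0 <= M by apply: le_trans (wM 0).
have := @volterra_op_lipschitz w (cst 0) M M t mw _ wM.
rewrite {2}/volterra_op; under eq_Rintegral do rewrite mulr0.
rewrite [X in q * X](_ : _ = 0) ?mulr0 ?subr0; last first.
  by rewrite /Rintegral integral0_eq.
apply => //= s; first by rewrite normr0.
by rewrite subr0.
Qed.

(** The jump of [w] at 0 is seen only by the [u] with [u^4 = t], a null set. *)
Lemma continuous_volterra_op (w : R -> R) (M : R) : continuous_off0 w ->
  (forall t, `|w t| <= M) -> continuous (volterra_op w).
Proof.
move=> cw wM t.
have mw := continuous_off0_measurable cw.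
apply/(@cvg_nbhsP _ R^o) => t_ t_t.
apply: cvgMr => //.
apply: (@Rintegral_dominated_cvg _ setT
  (fun n u => expR (- (sg * u ^+ 4)) * w (t_ n - u ^+ 4)) _
  (fun u => M * k u)) => //.
- move=> n; exact: integrable_measurable_fun (volterra_integrable _ mw wM).
- exact: integrable_measurable_fun (volterra_integrable _ mw wM).
- apply: filterS (ae_quartic_neq t) => [|u ut _].
    exact: (ae_filter_ringOfSetsType mu).
  apply: cvgM; first exact: cvg_cst.
  have h : t_ n - u ^+ 4 @[n --> \oo] --> t - u ^+ 4.
    by apply: cvgB t_t _; exact: cvg_cst.
  by apply: (cvg_comp _ w h); apply: cw; rewrite subr_eq0 eq_sym.
- exact: (integrableZl measurableT M k_integrable).
- move=> n u _.
  by rewrite normrM ger0_norm ?expR_ge0// mulrC ler_wpM2r ?expR_ge0.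
Qed.

Definition causal (w : R -> R) (t : R) : R := if 0 <= t then w t else 0.

Lemma continuous_causal (w : R -> R) :
  (forall t : R, 0 < t -> {for t, continuous w}) -> continuous_off0 (causal w).
Proof.
move=> cw t t0; rewrite /prop_for /continuous_at.
have [tp|tn] := ltP 0 t.
  have -> : causal w t = w t by rewrite /causal ltW.
  apply: cvg_trans (cw _ tp); apply: near_eq_cvg; near=> s.
  by rewrite /causal ltW//; near: s; exact: lt_nbhsr.
have {}tn : t < 0 by rewrite lt_neqAle t0.
have -> : causal w t = 0 by rewrite /causal leNgt tn.
apply: cvg_near_cst; near=> s.
by rewrite /causal leNgt ifF//; apply/negbF; near: s; exact: lt_nbhsl.
Unshelve. all: by end_near. Qed.

Lemma causal_le (w : R -> R) (M t : R) : 0 <= M -> (forall t, `|w t| <= M) ->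
  `|causal w t| <= M.
Proof. by move=> M0 wM; rewrite /causal; case: ifP => // _; rewrite normr0. Qed.

Section fixed_point.
Variables (f : R -> R) (C : R).
Hypotheses (cf : continuous_off0 f) (fC : forall t, `|f t| <= C).

Let C0 : 0 <= C. Proof. exact: le_trans (fC 0). Qed.

(** Picard iteration for [v = volterra_op (causal (f - v))]. *)
Fixpoint picard (n : nat) : R -> R :=
  if n is n'.+1 then volterra_op (causal (fun t => f t - picard n' t))
  else cst 0.

Let rhs_off0 (v : R -> R) : continuous v ->
  continuous_off0 (causal (fun t => f t - v t)).
Proof.
  move=> cv; apply: continuous_causal => t t0; apply: cvgB; last exact: cv.
  by apply: cf; rewrite gt_eqF.
 Qed.

Let rhs_le (v : R -> R) t : (forall t, `|v t| <= C) ->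
  `|causal (fun t => f t - v t) t| <= C + C.
Proof.
move=> vC; apply: causal_le; first exact: addr_ge0.
by move=> s; rewrite (le_trans (ler_normB _ _))// lerD.
Qed.

Lemma picard_spec n : continuous (picard n) /\ forall t, `|picard n t| <= C.
Proof.
elim: n => [|n [cn nC]].
  by split=> t /=; [exact: cvg_cst|rewrite normr0].
have wC := fun t => rhs_le t nC.
split=> [|t] /=; first exact: (continuous_volterra_op (rhs_off0 cn) wC).
rewrite (le_trans (volterra_op_le t _ wC))//; last lra.
exact: continuous_off0_measurable (rhs_off0 cn).
Qed.

Let volterra_rhs_lipschitz (v1 v2 : R -> R) (m t : R) :
  continuous v1 -> continuous v2 ->
  (forall t, `|v1 t| <= C) -> (forall t, `|v2 t| <= C) ->
  (forall t, `|v1 t - v2 t| <= m) ->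
  `|volterra_op (causal (fun t => f t - v1 t)) t
  - volterra_op (causal (fun t => f t - v2 t)) t| <= m / 2.
Proof.
move=> c1 c2 b1 b2 d.
apply: (@volterra_op_lipschitz _ _ (C + C)).
- exact: continuous_off0_measurable (rhs_off0 c1).
- exact: continuous_off0_measurable (rhs_off0 c2).
- by move=> s; exact: rhs_le.
- by move=> s; exact: rhs_le.
- move=> s; rewrite /causal; case: ifP => _.
    rewrite (_ : f s - v1 s - (f s - v2 s) = v2 s - v1 s); last by ring.
    by rewrite distrC.
  by rewrite subrr normr0; exact: le_trans (d s).
Qed.

Lemma picard_step n t : `|picard n.+1 t - picard n t| <= C / 2 ^+ n.
Proof.
elim: n t => [|n IH] t.
  by rewrite expr0 divr1 [picard 0]/= subr0; exact: (picard_spec 1).2.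
rewrite exprSr invfM mulrA.
by apply: (@volterra_rhs_lipschitz (picard n.+1) (picard n)) => //;
  by apply picard_spec.
Qed.

(** Sum of the geometric series that bounds the steps; the induction needs the
    exact partial sum. *)
Lemma picard_cauchy n j t : `|picard (n + j) t - picard n t| <= 2 * C / 2 ^+ n.
Proof.
suff : `|picard (n + j) t - picard n t| <= 2 * C / 2 ^+ n * (1 - 2^-1 ^+ j).
  move=> /le_trans; apply.
  have A0 : 0 <= 2 * C / 2 ^+ n by rewrite divr_ge0 ?exprn_ge0// mulr_ge0.
  by rewrite ler_piMr// gerBl exprn_ge0// invr_ge0.
elim: j => [|j IH]; first by rewrite addn0 subrr normr0 expr0 subrr mulr0.
rewrite addnS -(subrKA (picard (n + j) t)) (le_trans (ler_normD _ _))//.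
apply: le_trans (lerD (picard_step _ _) IH) _.
rewrite exprD invfM -[(2 ^+ j)^-1]exprVn exprS le_eqVlt.
apply/orP; left; apply/eqP.
by move: (2^-1 ^+ j) ((2 ^+ n)^-1) => y z; field.
Qed.

Lemma picard_cvg t : cvg (picard n t @[n --> \oo]).
Proof.
apply: cauchy_cvg; apply: cauchy_exP => e e0.
have h : 2 * C * 2^-1 ^+ n @[n --> \oo] --> (0 : R).
  rewrite -[X in _ --> X](mulr0 (2 * C)); apply: cvgMr; apply: cvg_expr.
  by rewrite ger0_norm// invf_lt1// ltr1n.
have [N _ hN] := (cvgrPdist_lt _ _).1 h e e0.
exists (picard N t); exists N => // n /= Nn.
have := hN N (leqnn N); rewrite /= sub0r normrN => eN.
rewrite /ball/= -(subnKC Nn) distrC (le_lt_trans (picard_cauchy _ _ _))//.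
by rewrite -exprVn (le_lt_trans (ler_norm _)).
Qed.

Definition picard_lim (t : R) : R := lim (picard n t @[n --> \oo]).

Lemma picard_lim_dist n t : `|picard_lim t - picard n t| <= 2 * C / 2 ^+ n.
Proof.
have h0 : picard (j + n)%N t @[j --> \oo] --> picard_lim t.
  by rewrite (cvg_shiftn n (picard ^~ t)); exact: picard_cvg.
have h : `|picard (n + j) t - picard n t| @[j --> \oo] -->
    `|picard_lim t - picard n t|.
  apply: cvg_norm; apply: cvgB; last exact: cvg_cst.
  by under eq_fun do rewrite addnC.
by apply: (cvgr_to_le h); apply: nearW => j; exact: picard_cauchy.
Qed.

Let geometric_tail_lt e : 0 < e -> exists n, 2 * C / 2 ^+ n < e :> R.
Proof.
move=> e0.
have h : 2 * C * 2^-1 ^+ n @[n --> \oo] --> (0 : R).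
  rewrite -[X in _ --> X](mulr0 (2 * C)); apply: cvgMr; apply: cvg_expr.
  by rewrite ger0_norm// invf_lt1// ltr1n.
have [N _ hN] := (cvgrPdist_lt _ _).1 h e e0.
exists N; have := hN N (leqnn N); rewrite /= sub0r normrN -exprVn.
by apply: le_lt_trans; exact: ler_norm.
Qed.

Lemma picard_lim_continuous : continuous picard_lim.
Proof.
move=> t; apply/cvgrPdist_lt => e e0.
have [n ne] := geometric_tail_lt (divr_gt0 e0 (ltr0Sn R 2)).
have ct := (picard_spec n).1 t.
near=> s.
have -> : picard_lim t - picard_lim s = (picard_lim t - picard n t)
   + (picard n t - picard n s) - (picard_lim s - picard n s) by ring.
rewrite (le_lt_trans (ler_normB _ _))//.
rewrite (le_lt_trans (lerD (ler_normD _ _) (lexx _)))//.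
have h1 := le_lt_trans (picard_lim_dist n t) ne.
have h2 := le_lt_trans (picard_lim_dist n s) ne.
have h3 : `|picard n t - picard n s| < e / 3.
  by near: s; apply: (cvgrPdist_lt _ _).1 ct _ _; rewrite divr_gt0.
by move: h1 h2 h3; lra.
Unshelve. all: by end_near. Qed.

Lemma picard_lim_le t : `|picard_lim t| <= C.
Proof.
have h : `|picard n t| @[n --> \oo] --> `|picard_lim t|.
  by apply: cvg_norm; exact: picard_cvg.
by apply: (cvgr_to_le h); apply: nearW => n; exact: (picard_spec n).2.
Qed.

Lemma picard_lim_fixed t :
  picard_lim t = volterra_op (causal (fun t => f t - picard_lim t)) t.
Proof.
apply/eqP; rewrite -subr_eq0 -normr_eq0; apply/eqP/le_anti.
rewrite normr_ge0 andbT.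
apply/ler_addgt0Pr => e e0; rewrite add0r.
have [n ne] := geometric_tail_lt (divr_gt0 e0 (ltr0Sn R 1)).
have h1 := picard_lim_dist n.+1 t.
have h2 := volterra_rhs_lipschitz t picard_lim_continuous (picard_spec n).1
  picard_lim_le (picard_spec n).2 (picard_lim_dist n).
set a := volterra_op _ t in h2 *.
have -> : picard_lim t - a = (picard_lim t - picard n.+1 t) - (a - picard n.+1 t).
  by ring.
rewrite (le_trans (ler_normB _ _))//.
have h3 : 2 * C / 2 ^+ n.+1 = (2 * C / 2 ^+ n) / 2.
  by rewrite exprSr invfM mulrA.
move: h1 h2; rewrite h3 /=; move: ne.
by set z := 2 * C / 2 ^+ n; lra.
Qed.

End fixed_point.
End volterra.

(** * Complex powers and uniqueness of solutions *)

Section laplace.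
Context {R : realType}.
Local Open Scope complex_scope.
Local Notation mu := (@lebesgue_measure R).

Lemma laplace_integrandE (b : R -> R) (x y t : R) :
  laplace_integrand b (x +i* y) t =
  (expR (- (x * t)) * cos (y * t) * b t) +i*
  (- (expR (- (x * t)) * sin (y * t) * b t)).
Proof.
rewrite /laplace_integrand /cexp /=; simpc.
by rewrite /= cosN sinN mulrN mulNr.
Qed.

Lemma cpowE (x y a : R) :
  let la := ln (Num.sqrt (x ^+ 2 + y ^+ 2)) in
  let th := atan (y / x) in
  cpow (x +i* y) a =
  (expR (a * la) * cos (a * th)) +i* (expR (a * la) * sin (a * th)).
Proof. by rewrite /cpow /cexp /clog /=; simpc. Qed.

Lemma polar (x y : R) : 0 < x ->
  let la := ln (Num.sqrt (x ^+ 2 + y ^+ 2)) in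
  let th := atan (y / x) in
  [/\ `|th| < pi / 2, expR la * cos th = x & expR la * sin th = y].
Proof.
move=> x0 la th.
have pos : 0 < x ^+ 2 + y ^+ 2 by rewrite ltr_pwDl ?exprn_gt0 ?sqr_ge0.
have thpi : `|th| < pi / 2 by rewrite ltr_norml atan_gtNpi2 atan_ltpi2.
have cth : expR la * cos th = x.
  rewrite /la lnK ?posrE ?sqrtr_gt0// /th cos_atan.
  have -> : x ^+ 2 + y ^+ 2 = x ^+ 2 * (1 + (y / x) ^+ 2).
    by field; rewrite gt_eqF.
  rewrite sqrtrM ?sqr_ge0// sqrtr_sqr gtr0_norm// mulfK//.
  by rewrite gt_eqF// sqrtr_gt0 ltr_pwDl ?sqr_ge0.
split => //.
have c0 : cos th != 0 by rewrite gt_eqF// cos_gt0_pihalf// -ltr_norml.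
have -> : sin th = (y / x) * cos th.
  by rewrite -[y / x]atanK /tan divfK.
by rewrite mulrCA cth divfK// gt_eqF.
Qed.

Lemma laplace_real (b : R -> R) (x : R) :
  laplace b (x +i* 0) =
  (\int[mu]_(t in `[0, +oo[) (expR (- (x * t)) * b t)) +i* 0.
Proof.
rewrite /laplace; congr (_ +i* _).
  by apply: eq_Rintegral => t _; rewrite laplace_integrandE/= mul0r cos0 mulr1.
rewrite /Rintegral integral0_eq// => t _.
by rewrite laplace_integrandE/= mul0r sin0 mulr0 mul0r oppr0.
Qed.

Lemma laplace_converges_real (b : R -> R) (x : R) :
  laplace_converges b (x +i* 0) ->
  mu.-integrable `[0, +oo[ (EFin \o (fun t => expR (- (x * t)) * b t)).
Proof.
move=> [h _]; apply: eq_integrable h => // t _; rewrite /comp.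
by rewrite laplace_integrandE/= mul0r cos0 mulr1.
Qed.

Lemma cpow_real (x a : R) :
  cpow (x +i* 0) a = expR (a * ln (Num.sqrt (x ^+ 2 + 0 ^+ 2))) +i* 0.
Proof. by rewrite cpowE mul0r atan0 mulr0 cos0 sin0 mulr1 mulr0. Qed.

(** For real [p] the equation gives [(1 + k p^(-lambda)) L(b1 - b2) = 0] with a
    positive factor, so [b1 - b2] has a vanishing Laplace transform on a right
    half-line. *)
Lemma solution_ae_unique (lambda k : R) (b0 b1 b2 : R -> R) : 0 <= k ->
  is_solution lambda k b0 b1 -> is_solution lambda k b0 b2 ->
  {ae mu, forall t, 0 <= t -> b1 t = b2 t}.
Proof.
move=> k0 [g1 [s1 _ h1] e1] [g2 [s2 _ h2] e2].
suff : {ae mu, forall t, 0 <= t -> b1 t - b2 t = 0}.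
  apply: filterS => [|t + t0]; first exact: (ae_filter_ringOfSetsType mu).
  by move=> /(_ t0)/subr0_eq.
apply: (@laplace_injective _ _ (Num.max s1 s2)) => x.
rewrite gt_max => /andP[xs1 xs2].
have := h1 (x +i* 0) xs1; have := h2 (x +i* 0) xs2.
rewrite cpow_real; set r := expR _.
have r0 : 0 < r by exact: expR_gt0.
rewrite !laplace_real.
move=> [/laplace_converges_real ib2 /laplace_converges_real ig2 /eqP].
rewrite eq_complex/= mul0r subr0 => /andP[/eqP l2 _].
move=> [/laplace_converges_real ib1 /laplace_converges_real ig1 /eqP].
rewrite eq_complex/= mul0r subr0 => /andP[/eqP l1 _].
have dE : \int[mu]_(t in `[0, +oo[) (expR (- (x * t)) * (b1 t - b2 t)) =
    \int[mu]_(t in `[0, +oo[) (expR (- (x * t)) * b1 t) -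
    \int[mu]_(t in `[0, +oo[) (expR (- (x * t)) * b2 t).
  by rewrite -RintegralB//; apply: eq_Rintegral => t _; rewrite mulrBr.
have gE : \int[mu]_(t in `[0, +oo[) (expR (- (x * t)) * (b1 t - b2 t)) =
    - k * (\int[mu]_(t in `[0, +oo[) (expR (- (x * t)) * g1 t) -
    \int[mu]_(t in `[0, +oo[) (expR (- (x * t)) * g2 t)).
  rewrite -RintegralB// -RintegralZl//; last exact: (integrableB _ ig1 ig2).
  apply: eq_Rintegral => t; rewrite inE/= in_itv/= andbT => t0.
  by rewrite e1// e2//; ring.
split.
  apply: eq_integrable (integrableB _ ib1 ib2) => // t _.
  by rewrite /= -EFinB mulrBr.
move: gE; rewrite dE l1 l2 -mulrBr => /eqP; rewrite -subr_eq0.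
rewrite (_ : _ - _ = (1 + k * r) *
  (\int[mu]_(t in `[0, +oo[) (expR (- (x * t)) * b1 t) -
   \int[mu]_(t in `[0, +oo[) (expR (- (x * t)) * b2 t))); last by ring.
rewrite mulf_eq0 gt_eqF/=; last by rewrite ltr_pwDl// mulr_ge0// ltW.
by move=> /eqP.
Qed.

(** The two functions differ on a relatively open set, which contains an
    interval of positive length as soon as it is not empty. *)
Lemma within_continuous_ae_eq (f1 f2 : R -> R) :
  {within `[0, +oo[, continuous f1} -> {within `[0, +oo[, continuous f2} ->
  {ae mu, forall t, 0 <= t -> f1 t = f2 t} -> forall t : R, 0 <= t -> f1 t = f2 t.
Proof.
move=> /subspace_continuousP c1 /subspace_continuousP c2 [N [mN N0 sub]] t t0.
apply/eqP; apply: contraT => ne.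
have tA : [set` `[(0 : R), +oo[] t by rewrite /= in_itv/= t0.
have c : f1 s - f2 s @[s --> within `[0, +oo[ (nbhs t)] --> f1 t - f2 t.
  by apply: cvgB; [exact: c1|exact: c2].
have ne0 : 0 < `|f1 t - f2 t| by rewrite normr_gt0 subr_eq0.
have [d /= d0 hd] := (cvgrPdist_lt _ _).1 c _ ne0.
have sN : `[t, (t + d)[ `<=` N.
  move=> s; rewrite /= in_itv/= => /andP[ts sd]; apply: sub => /= h.
  have s0 : 0 <= s by exact: le_trans ts.
  have bs : ball_ (fun x : R => `|x|) t d s by rewrite /= ltr_distlC; lra.
  have := hd s bs; rewrite in_itv/= s0 => /(_ isT).
  by rewrite (h s0) subrr subr0 ltxx.
have : (mu [set` `[t, (t + d)%R[%R] <= mu N)%E.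
  by apply: le_measure => //; rewrite inE.
rewrite N0 /= lebesgue_measure_itv/= lte_fin ltrDl d0 -EFinB addrAC subrr add0r.
by rewrite lee_fin leNgt d0.
Qed.

End laplace.

(** * Existence of a continuous solution *)

Section existence.
Context {R : realType}.
Local Open Scope complex_scope.
Local Notation mu := (@lebesgue_measure R).

(** The solution is [b = exp (sg t) v], where [v] is the fixed point of the
    weighted Volterra equation; [w] is the weighted form of [b0 - b = k g].
    Hence [b] is the convolution of [t^(-3/4)] with [g], up to the constant that
    turns [t^(-3/4)] into [Phi_(1/4)], and the convolution theorem gives
    [L(b) = p^(-1/4) L(g)] for [Re p > sg]. *)
Section construction.
Variables (k C : R) (b0 : R -> R).
Hypotheses (k0 : 0 < k) (b0_cont : {within `[0, +oo[, continuous b0}).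
Hypothesis b0C : forall t, 0 <= t -> `|b0 t| <= C.

Let q : R := (k * quartic_mass)^-1.

(** The kernel has mass [q * quartic_mass * sg^(-1/4) = sg^(-1/4) / k], which is
    at most 1/2 for this [sg] because [exp (2 / k) >= 2 / k]. *)
Let sg : R := expR (8 / k).

Let q_gt0 : 0 < q. Proof. by rewrite invr_gt0 mulr_gt0// quartic_mass_gt0. Qed.

Let sg_gt0 : 0 < sg. Proof. exact: expR_gt0. Qed.

Let q_half : q * quartic_cos sg 0 <= 2^-1.
Proof.
have th0 : `|0 : R| < pi / 2 by rewrite normr0 divr_gt0// pi_gt0.
have [+ _] := quartic_laplace (8 / k) th0.
rewrite !mul0r cos0 sin0 mulr0 mulr1 mul0r addr0 mul1r -/sg => h.
have e2 : 2 / k <= expR (8 / k / 4).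
  have -> : 8 / k / 4 = 2 / k by field; rewrite gt_eqF.
  by apply: le_trans (expR_ge1Dx _); rewrite lerDr.
have m0 := @quartic_mass_gt0 R.
have c0 : 0 < quartic_cos sg 0.
  by move: m0; rewrite -h pmulr_rgt0 ?expR_gt0.
rewrite /q mulrC ler_pdivrMr ?mulr_gt0// -h.
have : 2 <= k * expR (8 / k / 4) by rewrite mulrC -ler_pdivrMr.
set e := expR _; move: (quartic_cos _ _) c0 => z z0 ke.
by rewrite mulrA mulrA mulrC ler_peMr ?(ltW z0)//; lra.
Qed.

Let f : R -> R := causal (fun t => expR (- (sg * t)) * b0 t).

Let C_ge0 : 0 <= C. Proof. exact: le_trans (b0C (lexx 0)). Qed.

Let cf : continuous_off0 f.
Proof.
apply: continuous_causal => t t0; apply: cvgM.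
  apply: continuous_comp; last exact: continuous_expR.
  by apply: cvgN; apply: cvgMr => //; exact: cvg_id.
have /continuous_within_itvcyP[c _] := b0_cont.
by apply: c; rewrite in_itv/= andbT.
Qed.

Let fC t : `|f t| <= C.
Proof.
rewrite /f /causal; case: ifPn => [t0|_]; last by rewrite normr0.
rewrite normrM ger0_norm ?expR_ge0// (le_trans _ (b0C t0))// ler_piMl//.
by rewrite expR_le1 oppr_le0 mulr_ge0// ltW.
Qed.

Let v : R -> R := picard_lim sg q f.
Let w : R -> R := causal (fun t => f t - v t).

Let q_ge0 := ltW q_gt0.
Let v_cont : continuous v := picard_lim_continuous sg_gt0 q_ge0 q_half cf fC.
Let v_le t : `|v t| <= C := picard_lim_le sg_gt0 q_ge0 q_half cf fC t.
Let v_fixed t : v t = volterra_op sg q w t :=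
  picard_lim_fixed sg_gt0 q_ge0 q_half cf fC t.

Let w_meas : measurable_fun setT w.
Proof.
apply: continuous_off0_measurable; apply: continuous_causal => t t0.
by apply: cvgB; [apply: cf; rewrite gt_eqF|exact: v_cont].
Qed.

Let w_le t : `|w t| <= 2 * C.
Proof.
apply: causal_le; first by rewrite mulr_ge0.
by move=> s; rewrite (le_trans (ler_normB _ _))// mulr_natl mulr2n lerD.
Qed.

Let w_neg t : t < 0 -> w t = 0.
Proof. by move=> t0; rewrite /w /causal leNgt t0. Qed.

Let v_neg t : t < 0 -> v t = 0.
Proof.
move=> t0; rewrite v_fixed /volterra_op /Rintegral integral0_eq ?mulr0// => u _.
by rewrite w_neg ?mulr0// (le_lt_trans _ t0)// gerBl exprn_even_ge0.
Qed.

Let b (t : R) : R := expR (sg * t) * v t.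
Let g (t : R) : R := (b0 t - b t) / k.

Let g_w t : 0 <= t -> g t = k^-1 * (expR (sg * t) * w t).
Proof.
move=> t0; rewrite /g /b /w /causal t0 /f /causal t0 mulrBr mulrA -expRD subrr.
by rewrite expR0 mul1r mulrC.
Qed.

(** The Laplace transforms of [b] and [g] at [p = x + i y]. The addition
    formulas for [exp (- p t)], [t = u^4 + (t - u^4)], give the real and the
    imaginary part of [exp (- p t) b t] as combinations of the convolutions of
    the two parts of [exp (- p u^4)] with those of [exp (- p s) k g s]. *)
Section transform.
Variables x y : R.
Hypothesis xsg : sg < x.

Let x0 : 0 < x. Proof. exact: lt_trans xsg. Qed.

Let Fc (t : R) : R := expR (- (x * t)) * cos (y * t) * (expR (sg * t) * w t).
Let Fs (t : R) : R := expR (- (x * t)) * sin (y * t) * (expR (sg * t) * w t).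

Let weight_le (trig : R -> R) t : (forall z, `|trig z| <= 1) ->
  0 <= t ->
  `|expR (- (x * t)) * trig (y * t) * (expR (sg * t) * w t)| <=
  2 * C * expR (- ((x - sg) * t)).
Proof.
move=> trig1 t0.
rewrite [X in `|X|](_ : _ = trig (y * t) * w t * expR (- ((x - sg) * t)));
  last first.
  rewrite (_ : - ((x - sg) * t) = - (x * t) + sg * t) ?expRD; last by ring.
  by ring.
rewrite normrM (ger0_norm (expR_ge0 _)) ler_wpM2r ?expR_ge0// normrM.
by rewrite -[leRHS]mul1r ler_pM.
Qed.

Let weight_neg (trig : R -> R) t : t < 0 ->
  expR (- (x * t)) * trig (y * t) * (expR (sg * t) * w t) = 0.
Proof. by move=> t0; rewrite w_neg// !mulr0. Qed.

Let weight_bounded (trig : R -> R) t : (forall z, `|trig z| <= 1) ->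
  `|expR (- (x * t)) * trig (y * t) * (expR (sg * t) * w t)| <= 2 * C.
Proof.
move=> trig1; have [t0|t0] := ltP t 0.
  by rewrite weight_neg// normr0 mulr_ge0.
rewrite (le_trans (weight_le trig1 t0))// ler_piMr ?mulr_ge0//.
by rewrite expR_le1 oppr_le0 mulr_ge0// subr_ge0 ltW.
Qed.

Let weight_integrable (trig : R -> R) : (forall z, `|trig z| <= 1) ->
  measurable_fun setT trig ->
  mu.-integrable setT (EFin \o
    (fun t => expR (- (x * t)) * trig (y * t) * (expR (sg * t) * w t))).
Proof.
move=> trig1 mtrig.
apply: (@exp_halfline_integrable _ (x - sg) (2 * C)).
- by rewrite subr_gt0.
- apply: measurable_funM; apply: measurable_funM => //.
  + by apply: measurableT_comp => //; apply: measurableT_comp => //;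
      exact: measurable_funM.
  + by apply: measurableT_comp => //; exact: measurable_funM.
  + by apply: measurableT_comp => //; exact: measurable_funM.
- by move=> t; exact: weight_neg.
- by move=> t; exact: weight_le.
Qed.

Let mcos : measurable_fun setT (@cos R).
Proof. by apply: continuous_measurable_fun; exact: continuous_cos. Qed.

Let msin : measurable_fun setT (@sin R).
Proof. by apply: continuous_measurable_fun; exact: continuous_sin. Qed.

Let iFc : mu.-integrable setT (EFin \o Fc).
Proof. by apply: weight_integrable => //; exact: cos_max. Qed.

Let iFs : mu.-integrable setT (EFin \o Fs).
Proof. by apply: weight_integrable => //; exact: sin_max. Qed.

Let Fc_le t : `|Fc t| <= 2 * C.
Proof. by apply: weight_bounded; exact: cos_max. Qed.

Let Fs_le t : `|Fs t| <= 2 * C.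
Proof. by apply: weight_bounded; exact: sin_max. Qed.

Let ec (u : R) : R := expR (- (x * u ^+ 4)) * cos (y * u ^+ 4).
Let es (u : R) : R := expR (- (x * u ^+ 4)) * sin (y * u ^+ 4).

Let iec : mu.-integrable setT (EFin \o ec).
Proof. exact: quartic_exp_cos_integrable. Qed.

Let ies : mu.-integrable setT (EFin \o es).
Proof. exact: quartic_exp_sin_integrable. Qed.

Let JC : R := \int[mu]_t Fc t.
Let JS : R := \int[mu]_t Fs t.
Let conv (h F : R -> R) (t : R) : R := \int[mu]_u (h u * F (t - u ^+ 4)).

Let Bc (t : R) : R := expR (- (x * t)) * cos (y * t) * b t.
Let Bs (t : R) : R := expR (- (x * t)) * sin (y * t) * b t.

Let weight_split t u : expR (- (x * t)) * expR (sg * t) * expR (- (sg * u ^+ 4)) =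
  expR (- (x * u ^+ 4)) * expR (- (x * (t - u ^+ 4))) * expR (sg * (t - u ^+ 4)).
Proof. by rewrite -!expRD; congr expR; ring. Qed.

Let BcE t : Bc t = q * (conv ec Fc t - conv es Fs t).
Proof.
have [ic1 _ _] := quartic_convolution iec iFc Fc_le.
have [ic2 _ _] := quartic_convolution ies iFs Fs_le.
rewrite /Bc /b v_fixed /volterra_op /conv -RintegralB//.
rewrite [LHS](_ : _ = q * (expR (- (x * t)) * cos (y * t) * expR (sg * t) *
  \int[mu]_u (expR (- (sg * u ^+ 4)) * w (t - u ^+ 4)))); last by ring.
rewrite -RintegralZl//; last exact: (volterra_integrable sg_gt0 t w_meas w_le).
congr (q * _); apply: eq_Rintegral => u _; rewrite /ec /es /Fc /Fs.
have -> : y * t = y * u ^+ 4 + y * (t - u ^+ 4) by ring.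
rewrite cosD.
rewrite [LHS](_ : _ = expR (- (x * t)) * expR (sg * t) * expR (- (sg * u ^+ 4)) *
  ((cos (y * u ^+ 4) * cos (y * (t - u ^+ 4)) -
    sin (y * u ^+ 4) * sin (y * (t - u ^+ 4))) * w (t - u ^+ 4))); last by ring.
by rewrite weight_split; ring.
Qed.

Let BsE t : Bs t = q * (conv es Fc t + conv ec Fs t).
Proof.
have [ic1 _ _] := quartic_convolution ies iFc Fc_le.
have [ic2 _ _] := quartic_convolution iec iFs Fs_le.
rewrite /Bs /b v_fixed /volterra_op /conv -RintegralD//.
rewrite [LHS](_ : _ = q * (expR (- (x * t)) * sin (y * t) * expR (sg * t) *
  \int[mu]_u (expR (- (sg * u ^+ 4)) * w (t - u ^+ 4)))); last by ring.
rewrite -RintegralZl//; last exact: (volterra_integrable sg_gt0 t w_meas w_le).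
congr (q * _); apply: eq_Rintegral => u _; rewrite /ec /es /Fc /Fs.
have -> : y * t = y * u ^+ 4 + y * (t - u ^+ 4) by ring.
rewrite sinD.
rewrite [LHS](_ : _ = expR (- (x * t)) * expR (sg * t) * expR (- (sg * u ^+ 4)) *
  ((sin (y * u ^+ 4) * cos (y * (t - u ^+ 4)) +
    cos (y * u ^+ 4) * sin (y * (t - u ^+ 4))) * w (t - u ^+ 4))); last by ring.
by rewrite weight_split; ring.
Qed.

Let Bc_spec : mu.-integrable setT (EFin \o Bc) /\
  \int[mu]_t Bc t = q * (quartic_cos x y * JC - quartic_sin x y * JS).
Proof.
have [_ i1 e1] := quartic_convolution iec iFc Fc_le.
have [_ i2 e2] := quartic_convolution ies iFs Fs_le.
have -> : Bc = fun t => q * (conv ec Fc t - conv es Fs t)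
  by apply/funext => t; exact: BcE.
have i3 := integrableB measurableT i1 i2.
split; first exact: (integrableZl measurableT q i3).
by rewrite RintegralZl// RintegralB// e1 e2.
Qed.

Let Bs_spec : mu.-integrable setT (EFin \o Bs) /\
  \int[mu]_t Bs t = q * (quartic_sin x y * JC + quartic_cos x y * JS).
Proof.
have [_ i1 e1] := quartic_convolution ies iFc Fc_le.
have [_ i2 e2] := quartic_convolution iec iFs Fs_le.
have -> : Bs = fun t => q * (conv es Fc t + conv ec Fs t)
  by apply/funext => t; exact: BsE.
have i3 := integrableD measurableT i1 i2.
split; first exact: (integrableZl measurableT q i3).
by rewrite RintegralZl// RintegralD// e1 e2.
Qed.

Let b_neg t : t < 0 -> b t = 0.
Proof. by move=> t0; rewrite /b v_neg// mulr0. Qed.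

Let laplace_b : laplace_converges b (x +i* y) /\
  laplace b (x +i* y) = (\int[mu]_t Bc t) +i* (- \int[mu]_t Bs t).
Proof.
have [ic _] := Bc_spec; have [js _] := Bs_spec.
have ic' := integrable_halfline ic.
have js' := integrable_halfline js.
split; first split.
- by apply: eq_integrable ic' => // t _; rewrite /comp laplace_integrandE.
- apply: eq_integrable (integrableN js') => // t _.
  by rewrite /comp laplace_integrandE.
rewrite /laplace; congr (_ +i* _).
- rewrite -Rintegral_halfline; last by move=> t t0; rewrite /Bc b_neg// mulr0.
  by apply: eq_Rintegral => t _; rewrite laplace_integrandE.
- rewrite -Rintegral_halfline; last by move=> t t0; rewrite /Bs b_neg// mulr0.
  rewrite -mulN1r -RintegralZl//.
  by apply: eq_Rintegral => t _; rewrite laplace_integrandE mulN1r.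
Qed.

Let laplace_g : laplace_converges g (x +i* y) /\
  laplace g (x +i* y) = (k^-1 * JC) +i* (- (k^-1 * JS)).
Proof.
have ic := integrable_halfline
  (integrableZl measurableT k^-1 iFc).
have js := integrable_halfline
  (integrableZl measurableT (- k^-1) iFs).
have E t : 0 <= t -> laplace_integrand g (x +i* y) t =
    (k^-1 * Fc t) +i* (- k^-1 * Fs t).
  move=> t0; rewrite laplace_integrandE g_w// /Fc /Fs.
  by congr (_ +i* _); ring.
have E' t : t \in `[(0 : R), +oo[%classic -> laplace_integrand g (x +i* y) t =
    (k^-1 * Fc t) +i* (- k^-1 * Fs t).
  by rewrite inE/= in_itv/= andbT; exact: E.
split; first split.
- by apply: eq_integrable ic => // t /E'; rewrite /comp => ->.
- by apply: eq_integrable js => // t /E'; rewrite /comp => ->.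
rewrite /laplace -mulNr /JC /JS -!RintegralZl//; congr (_ +i* _).
- rewrite -Rintegral_halfline; last by move=> t t0; rewrite /Fc w_neg// !mulr0.
  by apply: eq_Rintegral => t /E' ->.
- rewrite -Rintegral_halfline; last by move=> t t0; rewrite /Fs w_neg// !mulr0.
  by apply: eq_Rintegral => t /E' ->.
Qed.

Lemma transform_relation :
  [/\ laplace_converges b (x +i* y), laplace_converges g (x +i* y) &
      laplace g (x +i* y) = cpow (x +i* y) (- - (1 / 4)) * laplace b (x +i* y)].
Proof.
have [cb ->] := laplace_b; have [cg ->] := laplace_g.
have [_ ->] := Bc_spec; have [_ ->] := Bs_spec.
split => //; rewrite cpowE.
have [] := polar y x0; set la := ln _; set th := atan _ => thpi xE yE.
have := quartic_laplace la thpi; rewrite /= xE yE => -[h1 h2].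
have -> : - - (1 / 4) * la = la / 4 by ring.
have -> : - - (1 / 4) * th = th / 4 by ring.
have qE : k^-1 = q * quartic_mass.
  by rewrite /q; field; rewrite !gt_eqF// quartic_mass_gt0.
rewrite qE -h1.
move: h2; move: (quartic_cos x y) (quartic_sin x y) => IC IS.
move: (expR (la / 4)) (cos (th / 4)) (sin (th / 4)) => e c s h2.
apply/eqP; rewrite eq_complex/=; apply/andP; split; apply/eqP.
- rewrite [RHS](_ : _ = q * (e * (c * IC + s * IS)) * JC -
    q * JS * (e * (c * IS - s * IC))); last by ring.
  by rewrite h2 mulr0 subr0.
- rewrite [RHS](_ : _ = - (q * (e * (c * IC + s * IS)) * JS) -
    q * JC * (e * (c * IS - s * IC))); last by ring.
  by rewrite h2 mulr0 subr0.
Qed.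

End transform.

Lemma exists_continuous_solution : exists2 b : R -> R,
  {within `[0, +oo[, continuous b} & is_solution (- (1 / 4)) k b0 b.
Proof.
exists b.
  apply: continuous_subspaceT => t; apply: cvgM; last exact: v_cont.
  apply: continuous_comp; last exact: continuous_expR.
  by apply: cvgMr; exact: cvg_id.
exists g; last by move=> t _; rewrite /g mulrCA divff ?gt_eqF// mulr1 subKr.
exists sg => [|[x y] /= xsg]; first exact: ltW.
exact: transform_relation.
Qed.

End construction.
End existence.

Theorem theorem3p2 (R : realType) (c C : R) (b0 db0 : R -> R)
    (c_gt0 : 0 < c) (C_gt0 : 0 < C)
    (b0_continuous : {within `[0, +oo[, continuous b0})
    (b0_derivative : is_derivative_Rplus b0 db0)
    (b0_bound : forall t, 0 <= t -> `|b0 t| + `|db0 t| <= C * (1 + t) ^- 2) :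
  let c1 : R := `|Gamma (- (1 / 4))| in
  exists b : R -> R,
    [/\ {within `[0, +oo[, continuous b},
        is_solution (- (1 / 4)) (c * c1) b0 b,
        (forall b' : R -> R, is_solution (- (1 / 4)) (c * c1) b0 b' ->
           {ae lebesgue_measure, forall t, 0 <= t -> b' t = b t}) &
        (forall b' : R -> R, {within `[0, +oo[, continuous b'} ->
           is_solution (- (1 / 4)) (c * c1) b0 b' ->
           forall t, 0 <= t -> b' t = b t)].
Proof.
move=> c1.
have k_gt0 : 0 < c * c1 by rewrite mulr_gt0// normr_gt0 Gamma_quarter_neq0.
have b0C t : 0 <= t -> `|b0 t| <= C.
  move=> t0; have h := b0_bound t t0.
  apply: le_trans (le_trans h _); first by rewrite lerDl.
  rewrite ler_pdivrMr ?exprn_gt0//; last by rewrite ltr_pwDl.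
  by rewrite ler_peMr ?(ltW C_gt0)// exprn_ege1// lerDl.
have [b cb sb] := exists_continuous_solution k_gt0 b0_continuous b0C.
exists b; split => // [b' sb'|b' cb' sb'].
  exact: solution_ae_unique (ltW k_gt0) sb' sb.
exact: within_continuous_ae_eq cb' cb (solution_ae_unique (ltW k_gt0) sb' sb).
Qed.
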